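(* Let $\Omega$ be a connected open set in $\mathbb C$ and $z_0\in\partial\Omega$. Let $u$ be a nonconstant holomorphic function on $\Omega$ that extends smoothly across $z_0$, with the extension still denoted by $u$, and with $u(z_0)=0$. Then the following statements are equivalent: (1) $u$ vanishes to finite order at $z_0$. (2) $\frac{|\bar\partial u|}{|u|}\in L^\infty$ near $z_0$ (i.e. on some neighborhood of $z_0$). (3) $\frac{|\bar\partial u|}{|u|}\in L^2$ near $z_0$ (i.e. on some neighborhood of $z_0$).
   Context: ''$u$ extends smoothly across $z_0$'' means that there is an open neighborhood $N$ of $z_0$ and a $C^\infty$ complex-valued function on $\Omega\cup N$ agreeing with $u$ on $\Omega$. With $z=x_1+ix_2$, $\bar\partial u=\frac12(\partial_{x_1}u+i\partial_{x_2}u)$. The quotient is taken where $u\neq0$ and set to be $0$ where $u=0$. $u$ vanishes to infinite order at $z_0$ (in the $L^2$ sense) if for all $m\ge0$, $\lim_{r\to0}r^{-m}\int_{|z-z_0|<r}|u|^2dv=0$, $dv$ being Lebesgue measure on $\mathbb C=\mathbb R^2$ (for smooth $u$ this is equivalent to the vanishing of all derivatives at $z_0$); otherwise it vanishes to finite order. *)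

(* Defs.v *)
From HB Require Import structures.
From mathcomp Require Import all_boot all_order all_algebra.
From mathcomp Require Import complex.
From mathcomp Require Import all_classical all_reals all_analysis.

Set Implicit Arguments.
Unset Strict Implicit.
Unset Printing Implicit Defensive.

Import Order.TTheory GRing.Theory Num.Theory.
Import numFieldNormedType.Exports.

Local Open Scope classical_set_scope.
Local Open Scope ring_scope.
Local Open Scope complex_scope.

(* The complex plane is [R[i]^o]: the alias [^o] is what gives [R[i]] its norm
   topology and makes it a normed space over the complex field [R[i]] itself.
   Real notions (partial derivatives, Lebesgue measure) live on [R * R]; beware
   that the library norm of [R * R] is the sup norm, so Euclidean discs are
   taken in [R[i]^o] and pulled back along [plane]. *)

Definition plane (R : realType) (p : R * R) : R[i]^o := p.1 +i* p.2.

Definition coords (R : realType) (z : R[i]^o) : R * R :=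
  (complex.Re z, complex.Im z).

Definition re_part (R : realType) (u : R[i]^o -> R[i]^o) (p : R * R) : R :=
  complex.Re (u (plane p)).

Definition im_part (R : realType) (u : R[i]^o -> R[i]^o) (p : R * R) : R :=
  complex.Im (u (plane p)).

Definition e1 (R : realType) : R * R := (1, 0).
Definition e2 (R : realType) : R * R := (0, 1).

Definition boundary (T : topologicalType) (A : set T) : set T :=
  closure A `\` interior A.

(* Scalars, domain and codomain are all complex, so this is complex
   differentiability. *)
Definition holomorphic_on (R : realType) (W : set R[i]^o)
    (u : R[i]^o -> R[i]^o) : Prop :=
  forall z, W z -> derivable u z 1.

Definition nonconstant_on (R : realType) (W : set R[i]^o)
    (u : R[i]^o -> R[i]^o) : Prop :=
  ~ exists c, forall z, W z -> u z = c.

(* For [W] open: the partial derivatives of order at most [k] exist and are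
   continuous on [W]. *)
Fixpoint Ck_on (R : realType) (k : nat) (W : set (R * R))
    (f : R * R -> R) : Prop :=
  (forall p, W p -> {for p, continuous f}) /\
  match k with
  | 0%N => True
  | k'.+1 => (forall p, W p -> derivable f p (e1 R) /\ derivable f p (e2 R)) /\
             Ck_on k' W ('D_(e1 R) f) /\ Ck_on k' W ('D_(e2 R) f)
  end.

Definition smooth_on (R : realType) (W : set R[i]^o)
    (u : R[i]^o -> R[i]^o) : Prop :=
  forall k : nat, Ck_on k (@plane R @^-1` W) (re_part u) /\
                  Ck_on k (@plane R @^-1` W) (im_part u).

Definition smooth_extension_across (R : realType) (W N : set R[i]^o)
    (z0 : R[i]^o) (u U : R[i]^o -> R[i]^o) : Prop :=
  [/\ open_nbhs z0 N, smooth_on (W `|` N) U & forall z, W z -> U z = u z].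

Definition partial (R : realType) (v : R * R) (u : R[i]^o -> R[i]^o)
    (z : R[i]^o) : R[i]^o :=
  ('D_v (re_part u) (coords z)) +i* ('D_v (im_part u) (coords z)).

Definition dbar (R : realType) (u : R[i]^o -> R[i]^o) (z : R[i]^o) : R[i]^o :=
  2^-1 * (partial (e1 R) u z + (0 +i* 1) * partial (e2 R) u z).

(* [normc] is the modulus with values in [R]; [`|z|] would lie in [R[i]]. *)
Definition dbar_quotient (R : realType) (u : R[i]^o -> R[i]^o)
    (z : R[i]^o) : R :=
  if u z == 0 then 0 else Normc.normc (dbar u z) / Normc.normc (u z).

Definition lebesgue2 (R : realType) :=
  (@lebesgue_measure R \x @lebesgue_measure R)%E.

Definition vanishes_to_infinite_order (R : realType) (u : R[i]^o -> R[i]^o)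
    (z0 : R[i]^o) : Prop :=
  forall m : nat,
    (fun r : R => (r ^- m)%:E *
       \int[@lebesgue2 R]_(p in @plane R @^-1` ball z0 r%:C)
          (Normc.normc (u (plane p)) ^+ 2)%:E)%E @ 0^'+ --> 0%E.

Definition vanishes_to_finite_order (R : realType) (u : R[i]^o -> R[i]^o)
    (z0 : R[i]^o) : Prop :=
  ~ vanishes_to_infinite_order u z0.

(* [g] is only meaningful on [D], so the neighbourhood is required to lie in
   [D]; membership in L^p of the neighbourhood [W] is membership in the
   library's L^p space of the extension of [g] by zero outside [W]. *)
Definition Lp_near (R : realType) (p : \bar R) (D : set R[i]^o) (z0 : R[i]^o)
    (g : R[i]^o -> R) : Prop :=
  exists W : set R[i]^o, [/\ open_nbhs z0 W, W `<=` D &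
    ((g \o @plane R) \_ (@plane R @^-1` W)) \in Lfun (@lebesgue2 R) p].

(* Main.v *)
Require Import Defs.
From HB Require Import structures.
From mathcomp Require Import all_boot all_order all_algebra.
From mathcomp Require Import complex.
From mathcomp Require Import all_classical all_reals all_analysis.
From mathcomp Require Import measurable_realfun ess_sup_inf.
From mathcomp Require Import ring lra.
Import Order.TTheory GRing.Theory Num.Theory.
Import numFieldNormedType.Exports.

Set Implicit Arguments.
Unset Strict Implicit.
Unset Printing Implicit Defensive.

Local Open Scope classical_set_scope.
Local Open Scope ring_scope.
Local Open Scope complex_scope.

(* On [Omega] the function [dbar U] vanishes, so it vanishes to infinite order
   at [z0] and the Taylor expansion of [U] at [z0] is a power series in
   [z - z0].  Either some coefficient is nonzero, and then [|U|] is bounded below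
   by a multiple of [|z - z0|^j] while [|dbar U|] is bounded above by one; or [U]
   is flat at [z0].  In the flat case a square-integrable quotient
   [|dbar U| / |U|] forces [U] to vanish near [z0], hence on the connected set
   [Omega], a contradiction.

   For this unique continuation, suppose [U a <> 0] for a point [a] near a zero
   [z] of infinite order.  With [s = |U|^2], the function
   [T = ln (s^2 + d^2) / 4] regularises [ln |U|]; its gradient is, up to a field
   bounded by the quotient, a rotation of the gradient of [arg U], whose curl
   counts zeros and is bounded below by minus the square of the quotient.  The
   divergence theorem, tested against the cube of the positive part of a
   function subharmonic away from [a] that carries a logarithmic term of scale
   [e] at [z], then bounds [- T] on the [e]-square about [z] by a multiple of
   [ln (1 / e)] with a constant independent of [e].  Flatness of [U] at [z]
   makes [- T] larger than any multiple of [ln (1 / e)]. *)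

(** The zeros of [U] shape the estimate. The quotient is 0 there by convention, as is [D / s] since
    dividing by 0 gives 0, while [dbar U] may be nonzero; so no positive error is affordable at a
    zero. Regularising with [s ^+ 2 + d ^+ 2] gives the gradient of [arg U] a factor
    [s / (s ^+ 2 + d ^+ 2)], and its curl becomes [4 * J * s * d ^+ 2 / (s ^+ 2 + d ^+ 2) ^+ 2] with
    [J] the Jacobian of [U], which vanishes with [s]. With [s + d ^+ 2] the curl at a zero would be
    a multiple of [J], of either sign. The subharmonic function has its bad region at [a] because
    [U] is nonzero there, which bounds [T] below exactly where the Laplacian may be negative. The
    logarithm is weighted by a multiple of [1 / ln (1 / e)], so that the function stays positive
    near [z]. This weight cancels the factor [ln (1 / e)] in [- T >= N * ln (1 / e) / 4], and a
    multiple of [N] remains, bounded by a quantity free of [N], [e] and [d]. *)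

Section partial_derivatives.
Context {R : realType}.

(** Reduces directional derivatives to one real variable, where the chain rule and the mean value
    theorem apply. *)
Lemma is_derive_line (V : normedModType R) (f : V -> R) p v d :
  is_derive p v f d <-> is_derive (0 : R) (1 : R) (fun t : R => f (t *: v + p)) d.
Proof.
have E : (fun h : R => h^-1 *: ((f \o shift p) (h *: v) - f p)) =
    (fun h : R => h^-1 *: (((fun t : R => f (t *: v + p)) \o shift 0) (h *: (1:R))
       - f ((0:R) *: v + p))).
  by apply/funext => h /=; rewrite addr0 scale0r add0r [_%:A]mulr1.
split=> -[df dv]; split; move: df dv; rewrite /derivable /derive E //.
Qed.

Implicit Types (W : set (R * R)) (f g : R * R -> R) (p v : R * R).

Lemma is_derive_comp1 f (phi : R -> R) p v df dphi :
  is_derive p v f df -> is_derive (f p) (1 : R) phi dphi ->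
  is_derive p v (phi \o f) (dphi * df).
Proof.
move=> /is_derive_line Hf Hp; apply/is_derive_line.
apply: (@is_derive1_comp _ phi (fun t : R => f (t *: v + p))).
by rewrite scale0r add0r.
Qed.

Definition continuous_on W f := forall p, W p -> {for p, continuous f}.

(** The partial derivatives are arguments rather than ['D_v f]. The closure lemmas below then
    assemble the gradient of a composite expression as a formula, which [ring] or [field] compares
    with the intended one. *)
Definition C1_on W f f1 f2 :=
  [/\ continuous_on W f, continuous_on W f1, continuous_on W f2 &
   forall p, W p -> is_derive p (e1 R) f (f1 p) /\ is_derive p (e2 R) f (f2 p)].

Lemma C1_on_cst W c : C1_on W (fun=> c) (fun=> 0) (fun=> 0).
Proof.
split=> p _; [exact: cvg_cst|exact: cvg_cst|exact: cvg_cst|].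
by split; exact: is_derive_cst.
Qed.

Lemma continuous_onD W f g : continuous_on W f -> continuous_on W g ->
  continuous_on W (fun p => f p + g p).
Proof. by move=> a b p Wp; apply: continuousD; [exact: a|exact: b]. Qed.

Lemma continuous_onN W f : continuous_on W f -> continuous_on W (fun p => - f p).
Proof. by move=> a p Wp; apply: continuousN; exact: a. Qed.

Lemma continuous_onM W f g : continuous_on W f -> continuous_on W g ->
  continuous_on W (fun p => f p * g p).
Proof. by move=> a b p Wp; apply: continuousM; [exact: a|exact: b]. Qed.

Lemma continuous_on_cst W c : continuous_on W (fun=> c).
Proof. by move=> p _; exact: cvg_cst. Qed.

Lemma C1_onD W f f1 f2 g g1 g2 : C1_on W f f1 f2 -> C1_on W g g1 g2 ->
  C1_on W (fun p => f p + g p) (fun p => f1 p + g1 p) (fun p => f2 p + g2 p).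
Proof.
move=> [a b c d] [a' b' c' d']; split; try exact: continuous_onD.
by move=> p Wp; have [? ?] := d p Wp; have [? ?] := d' p Wp; split; exact: is_deriveD.
Qed.

Lemma C1_onN W f f1 f2 : C1_on W f f1 f2 ->
  C1_on W (fun p => - f p) (fun p => - f1 p) (fun p => - f2 p).
Proof.
move=> [a b c d]; split; try exact: continuous_onN.
by move=> p Wp; have [? ?] := d p Wp; split; exact: is_deriveN.
Qed.

Lemma C1_onM W f f1 f2 g g1 g2 : C1_on W f f1 f2 -> C1_on W g g1 g2 ->
  C1_on W (fun p => f p * g p) (fun p => f1 p * g p + f p * g1 p)
    (fun p => f2 p * g p + f p * g2 p).
Proof.
move=> [a b c d] [a' b' c' d']; split.
- exact: continuous_onM.
- by apply: continuous_onD; exact: continuous_onM.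
- by apply: continuous_onD; exact: continuous_onM.
move=> p Wp; have [d1 d2] := d p Wp; have [d1' d2'] := d' p Wp.
split.
  apply: (is_derive_eq (is_deriveM d1 d1')).
  by rewrite /GRing.scale /= addrC mulrC.
apply: (is_derive_eq (is_deriveM d2 d2')).
by rewrite /GRing.scale /= addrC mulrC.
Qed.

Lemma C1_on_comp W f f1 f2 (phi dphi : R -> R) : C1_on W f f1 f2 ->
  (forall p, W p -> is_derive (f p) (1 : R) phi (dphi (f p))) ->
  (forall p, W p -> {for f p, continuous dphi}) ->
  C1_on W (fun p => phi (f p)) (fun p => dphi (f p) * f1 p)
    (fun p => dphi (f p) * f2 p).
Proof.
move=> [a b c d] dp cp.
have cphi p : W p -> {for f p, continuous phi}.
  move=> Wp; apply: differentiable_continuous; apply/derivable1_diffP.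
  by have [] := dp p Wp.
have cd : continuous_on W (fun p => dphi (f p)).
  by move=> p Wp; apply: continuous_comp; [exact: a|exact: cp].
split.
- by move=> p Wp; apply: continuous_comp; [exact: a|exact: cphi].
- exact: continuous_onM.
- exact: continuous_onM.
move=> p Wp; have [d1 d2] := d p Wp; split.
  exact: (is_derive_comp1 d1 (dp p Wp)).
exact: (is_derive_comp1 d2 (dp p Wp)).
Qed.

Lemma C1_on_eq W f f1 f2 g1 g2 : C1_on W f f1 f2 ->
  (forall p, W p -> f1 p = g1 p) -> (forall p, W p -> f2 p = g2 p) -> open W ->
  C1_on W f g1 g2.
Proof.
move=> [a b c d] E1 E2 oW.
have K h k : (forall p, W p -> h p = k p) -> continuous_on W h -> continuous_on W k.
  move=> E ch p Wp; have := ch p Wp; rewrite /prop_for /continuous_at -(E p Wp).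
  apply: cvg_trans; apply: near_eq_cvg.
  have : \forall q \near p, W q by apply: open_nbhs_nbhs; split.
  by apply: filterS => q /E.
split=> //; [exact: K b|exact: K c|].
by move=> p Wp; have [? ?] := d p Wp; rewrite -E1// -E2.
Qed.

Lemma C1_on_fst W : C1_on W fst (fun=> 1) (fun=> 0).
Proof.
split; [by move=> p _; exact: cvg_fst|exact: continuous_on_cst
  |exact: continuous_on_cst|].
move=> p _; split; apply/is_derive_line => /=.
  have -> : (fun t : R => t * 1 + p.1) = (id + cst p.1).
    by apply/funext => t /=; rewrite mulr1.
  by apply: is_derive_eq; rewrite addr0.
have -> : (fun t : R => t * 0 + p.1) = cst p.1.
  by apply/funext => t /=; rewrite mulr0 add0r.
exact: is_derive_cst.
Qed.

Lemma C1_on_snd W : C1_on W snd (fun=> 0) (fun=> 1).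
Proof.
split; [by move=> p _; exact: cvg_snd|exact: continuous_on_cst
  |exact: continuous_on_cst|].
move=> p _; split; apply/is_derive_line => /=; last first.
  have -> : (fun t : R => t * 1 + p.2) = (id + cst p.2).
    by apply/funext => t /=; rewrite mulr1.
  by apply: is_derive_eq; rewrite addr0.
have -> : (fun t : R => t * 0 + p.2) = cst p.2.
  by apply/funext => t /=; rewrite mulr0 add0r.
exact: is_derive_cst.
Qed.

Lemma C1_onV W f f1 f2 : C1_on W f f1 f2 -> (forall p, W p -> f p != 0) ->
  C1_on W (fun p => (f p)^-1) (fun p => - (f p ^- 2) * f1 p)
   (fun p => - (f p ^- 2) * f2 p).
Proof.
move=> Cf f0; apply: (C1_on_comp (phi := GRing.inv) (dphi := fun t => - t ^- 2) Cf).
  move=> p Wp; have := f0 _ Wp => fp0.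
  apply: is_derive_eq; first by apply: is_deriveV.
  by rewrite scaler1.
move=> p Wp; apply: continuousN; apply: continuousV; first by rewrite expf_neq0 ?f0.
exact: exprn_continuous.
Qed.

Lemma C1_on_ln W f f1 f2 : C1_on W f f1 f2 -> (forall p, W p -> 0 < f p) ->
  C1_on W (fun p => ln (f p)) (fun p => (f p)^-1 * f1 p)
   (fun p => (f p)^-1 * f2 p).
Proof.
move=> Cf f0; apply: (C1_on_comp (phi := @ln R) (dphi := GRing.inv) Cf).
  by move=> p Wp; apply: is_derive1_ln; exact: f0.
move=> p Wp; apply: continuousV; last exact: cvg_id.
by rewrite gt_eqF ?f0.
Qed.

End partial_derivatives.

(** * Powers of the positive part, from which the test function is built *)

Section positive_part.
Context {R : realType}.

Lemma max0_continuous : continuous (fun t : R => Num.max t 0).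
Proof.
move=> t; apply: (@continuous_max R R id (cst 0) t); first exact: cvg_id.
exact: cvg_cst.
Qed.

(** An exponent of at least 2 smooths the corner: at 0 the difference quotient is
    [Num.max h 0 ^+ n.+1], which tends to 0. Used for the cube and then for the square, this makes
    the cube a C^2 function. *)
Lemma is_derive_max0X n (x : R) :
  is_derive x (1 : R) (fun t : R => Num.max t 0 ^+ n.+2)
    (n.+2%:R * Num.max x 0 ^+ n.+1).
Proof.
have [x0|x0|->] := ltgtP x 0.
- rewrite expr0n mulr0.
  apply: (@near_eq_is_derive R R R (cst 0)).
  near=> t; rewrite max_r ?expr0n//.
  by apply: ltW; near: t; exact: lt_nbhsl.
-   apply: (@near_eq_is_derive R R R (id ^+ n.+2)).
    near=> t; rewrite max_l ?exprfctE//.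
    by apply: ltW; near: t; exact: lt_nbhsr.
  by apply: is_derive_eq; rewrite scaler1.
rewrite expr0n mulr0.
have c : (h^-1 *: (((fun t : R => Num.max t 0 ^+ n.+2) \o shift 0) (h *: (1:R)) -
    (fun t : R => Num.max t 0 ^+ n.+2) 0)) @[h --> 0^'] --> (0 : R).
  have H : Num.max h 0 ^+ n.+1 @[h --> (0 : R)] --> (0 : R).
    have : {for 0, continuous (fun h : R => Num.max h 0 ^+ n.+1)}.
      apply: (@continuous_comp _ _ _ (fun t : R => Num.max t 0) (fun t => t ^+ n.+1)).
        exact: max0_continuous.
      exact: exprn_continuous.
    by rewrite /prop_for /continuous_at maxxx expr0n.
  apply: cvg_trans (cvg_within_filter _ H).
  apply: near_eq_cvg; near=> h; have h0 : h != 0 by near: h; exact: nbhs_dnbhs_neq.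
  rewrite -[RHS]/(h^-1 * (Num.max (h * 1 + 0) 0 ^+ n.+2 - Num.max 0 0 ^+ n.+2)).
  rewrite maxxx expr0n subr0 addr0 mulr1 [_ ^+ n.+2]exprS mulrA.
  have [->|->] : Num.max h 0 = 0 \/ Num.max h 0 = h.
    by case: (leP h 0) => ?; [left|right].
  - by rewrite mulr0 mul0r exprS mul0r.
  - by rewrite mulVf// mul1r.
by split; [apply/cvg_ex; exists 0|exact: cvg_lim c].
Unshelve. all: by end_near. Qed.

Lemma C1_on_max0X (W : set (R * R)) f f1 f2 n : C1_on W f f1 f2 ->
  C1_on W (fun p => Num.max (f p) 0 ^+ n.+2)
    (fun p => n.+2%:R * Num.max (f p) 0 ^+ n.+1 * f1 p)
    (fun p => n.+2%:R * Num.max (f p) 0 ^+ n.+1 * f2 p).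
Proof.
move=> Cf; apply: (C1_on_comp (phi := fun t => Num.max t 0 ^+ n.+2)
   (dphi := fun t => n.+2%:R * Num.max t 0 ^+ n.+1) Cf).
  by move=> p _; exact: is_derive_max0X.
move=> p _; apply: cvgM; first exact: cvg_cst.
apply: (@continuous_comp _ _ _ (fun t : R => Num.max t 0) (fun t => t ^+ n.+1)).
  exact: max0_continuous.
exact: exprn_continuous.
Qed.

End positive_part.

(** * Mean value inequality on squares and symmetry of second derivatives *)

Section mean_value.
Context {R : realType}.
Implicit Types (W : set (R * R)) (f : R * R -> R) (p q z : R * R).

Lemma is_derive_slice1 f p d :
  is_derive p (e1 R) f d <-> is_derive p.1 (1 : R) (fun t => f (t, p.2)) d.
Proof.
rewrite is_derive_line (is_derive_line (fun t => f (t, p.2))).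
suff -> : (fun t : R => f (t *: e1 R + p)) = (fun t : R => f (t *: 1 + p.1, p.2)) by [].
by apply/funext => t; rewrite /e1; congr f; rewrite [LHS]surjective_pairing /= scaler0 add0r.
Qed.

Lemma is_derive_slice2 f p d :
  is_derive p (e2 R) f d <-> is_derive p.2 (1 : R) (fun t => f (p.1, t)) d.
Proof.
rewrite is_derive_line (is_derive_line (fun t => f (p.1, t))).
suff -> : (fun t : R => f (t *: e2 R + p)) = (fun t : R => f (p.1, t *: 1 + p.2)) by [].
by apply/funext => t; rewrite /e2; congr f; rewrite [LHS]surjective_pairing /= scaler0 add0r.
Qed.

(** Absolute values leave the order of [a] and [b] free, as increments from the centre of a square
    have either sign. *)
Lemma MVT_between (g dg : R -> R) a b :
  (forall t, `|t - a| <= `|b - a| -> is_derive t (1 : R) g (dg t)) ->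
  exists2 c, `|c - a| <= `|b - a| & g b - g a = dg c * (b - a).
Proof.
move=> H; have [ab|ba|->] := ltgtP a b.
- have [||c] := @MVT _ g dg a b ab.
  + move=> t; rewrite in_itv/= => /andP[at_ tb]; apply: H.
    by rewrite !ger0_norm; lra.
  + apply: derivable_within_continuous => t; rewrite in_itv/= => /andP[at_ tb].
    have [] // := H t _.
    by rewrite !ger0_norm; lra.
  rewrite in_itv/= => /andP[ac cb] E; exists c => //.
  by rewrite !ger0_norm; lra.
- have K t : b <= t <= a -> `|t - a| <= `|b - a|.
    move=> /andP[bt ta].
    by rewrite !ler0_norm; lra.
  have [||c] := @MVT _ g dg b a ba.
  + move=> t; rewrite in_itv/= => /andP[at_ tb]; apply: H; apply: K.
    by rewrite !ltW.
  + apply: derivable_within_continuous => t; rewrite in_itv/= => /K /H.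
    by case.
  rewrite in_itv/= => /andP[ac cb] E; exists c => //.
    by apply: K; rewrite !ltW.
  by rewrite -opprB E -mulrN opprB.
- by exists b; rewrite ?subrr ?mulr0.
Qed.

Lemma norm_prod_le p r : (`|p| <= r) = (`|p.1| <= r) && (`|p.2| <= r).
Proof. by rewrite prod_normE ge_max. Qed.

(** The path from [z] to [p] follows one axis and then the other. Both legs stay in the sup-norm
    ball of radius [|p - z|], and each contributes one [M]. *)
Lemma mean_value_square f f1 f2 z p M :
  (forall q, `|q - z| <= `|p - z| ->
     is_derive q (e1 R) f (f1 q) /\ is_derive q (e2 R) f (f2 q)) ->
  (forall q, `|q - z| <= `|p - z| -> `|f1 q| <= M /\ `|f2 q| <= M) ->
  `|f p - f z| <= M *+ 2 * `|p - z|.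
Proof.
move=> D B; set r := `|p - z| in D B *.
have /andP[r1 r2] : (`|p.1 - z.1| <= r) && (`|p.2 - z.2| <= r).
  by have := lexx r; rewrite {1}/r norm_prod_le.
have N0 : `|0 : R| <= r by rewrite normr0 /r.
have M0 : 0 <= M.
  by have [|+ _] := B z; [rewrite subrr normr0 /r|apply: le_trans].
have [t t1 Et] := @MVT_between (fun t => f (t, z.2)) (fun t => f1 (t, z.2)) z.1 p.1
  (fun t tz => (is_derive_slice1 f (t, z.2) (f1 (t, z.2))).1
    (D (t, z.2) ltac:(rewrite norm_prod_le /= subrr N0 andbT; exact: le_trans tz r1)).1).
have [s s1 Es] := @MVT_between (fun s => f (p.1, s)) (fun s => f2 (p.1, s)) z.2 p.2
  (fun t tz => (is_derive_slice2 f (p.1, t) (f2 (p.1, t))).1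
    (D (p.1, t) ltac:(rewrite norm_prod_le /= r1 /=; exact: le_trans tz r2)).2).
have -> : f p - f z = (f (p.1, p.2) - f (p.1, z.2)) + (f (p.1, z.2) - f (z.1, z.2)).
  by rewrite addrA subrK; case: (p) (z) => ? ? [].
rewrite Et Es; apply: (le_trans (ler_normD _ _)).
rewrite !normrM mulrnAl mulr2n; apply: lerD; apply: ler_pM => //.
  by apply: (B _ _).2; rewrite norm_prod_le /= r1 /=; exact: le_trans s1 r2.
by apply: (B _ _).1; rewrite norm_prod_le /= subrr N0 andbT; exact: le_trans t1 r1.
Qed.

Lemma second_difference (F F1 F12 : R -> R -> R) (x y t : R) :
  (forall s y', `|s - x| <= `|t| -> `|y' - y| <= `|t| ->
     is_derive s (1 : R) (F ^~ y') (F1 s y')) ->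
  (forall s y', `|s - x| <= `|t| -> `|y' - y| <= `|t| ->
     is_derive y' (1 : R) (F1 s) (F12 s y')) ->
  exists s y', [/\ `|s - x| <= `|t|, `|y' - y| <= `|t| &
    F (x + t) (y + t) - F (x + t) y - (F x (y + t) - F x y) = F12 s y' * t * t].
Proof.
move=> D1 D2.
have xt (u : R) : u + t - u = t by rewrite addrC addrA addNr add0r.
have := @MVT_between (fun s => F s (y + t) - F s y) (fun s => F1 s (y + t) - F1 s y)
  x (x + t).
rewrite xt => -[|s s1 Es].
  by move=> s sx; apply: is_deriveB; apply: D1; rewrite // ?xt// subrr normr0.
have := @MVT_between (F1 s) (F12 s) y (y + t); rewrite xt => -[|y' y1 Ey].
  by move=> y' yy; exact: D2.
by exists s, y'; split => //; rewrite Es Ey.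
Qed.

(** The double difference of [f] is symmetric in the two variables. Evaluated in both orders, it
    shows that [f12] and [f21] take a common value at two points near [p]; continuity at [p] does
    the rest. *)
Lemma mixed_partials_eq W f f1 f2 f11 f12 f21 f22 : open W ->
  C1_on W f f1 f2 -> C1_on W f1 f11 f12 -> C1_on W f2 f21 f22 ->
  forall p, W p -> f12 p = f21 p.
Proof.
move=> oW [_ _ _ D] [_ _ c12 D1] [_ c21 _ D2] p Wp.
apply/eqP; rewrite -subr_eq0 -normr_le0; apply/ler_addgt0Pr => e e0; rewrite add0r.
have e2 : 0 < e / 2 by rewrite divr_gt0.
have nW : nbhs p W by apply: open_nbhs_nbhs.
have n12 : \forall q \near p, `|f12 p - f12 q| <= e / 2.
  by apply: (@cvgrPdist_le _ _ _ _ _ _ _).1 (c12 p Wp) _ e2.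
have n21 : \forall q \near p, `|f21 p - f21 q| <= e / 2.
  by apply: (@cvgrPdist_le _ _ _ _ _ _ _).1 (c21 p Wp) _ e2.
have /nbhs_ballP[t /= t0 Ht] : nbhs p (W `&` ([set q | `|f12 p - f12 q| <= e / 2]
  `&` [set q | `|f21 p - f21 q| <= e / 2])) by exact: filterI nW (filterI n12 n21).
have t20 : 0 < t / 2 by rewrite divr_gt0.
have At : `|t / 2| = t / 2 by rewrite gtr0_norm.
have H s y' : `|s - p.1| <= `|t / 2| -> `|y' - p.2| <= `|t / 2| ->
   [/\ W (s, y'), `|f12 p - f12 (s, y')| <= e / 2 & `|f21 p - f21 (s, y')| <= e / 2].
  rewrite At => a b.
  have [|? [? ?]] := Ht (s, y'); last by split.
  rewrite -ball_normE /= -normrN opprB.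
  apply: (@le_lt_trans _ _ (t / 2)); last by rewrite ltr_pdivrMr// ltr_pMr// ltr1n.
  by rewrite norm_prod_le /= a b.
have [|| s [y' [a b E]]] :=
  @second_difference (fun s t => f (s, t)) (fun s t => f1 (s, t)) (fun s t => f12 (s, t))
   p.1 p.2 (t / 2).
- by move=> s y' a b; have [/D[? ?] _ _] := H s y' a b; apply/(is_derive_slice1 f (s, y')).
- by move=> s y' a b; have [/D1[? ?] _ _] := H s y' a b; apply/(is_derive_slice2 f1 (s, y')).
have [|| s' [y'' [a' b' E']]] :=
  @second_difference (fun t s => f (s, t)) (fun t s => f2 (s, t)) (fun t s => f21 (s, t))
   p.2 p.1 (t / 2).
- by move=> s1 y1 c d; have [/D[? ?] _ _] := H y1 s1 d c; apply/(is_derive_slice2 f (y1, s1)).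
- by move=> s1 y1 c d; have [/D2[? ?] _ _] := H y1 s1 d c; apply/(is_derive_slice1 f2 (y1, s1)).
have EE : f12 (s, y') = f21 (y'', s').
  have t2n : t / 2 != 0 by rewrite gt_eqF.
  by apply: (mulIf t2n); apply: (mulIf t2n); rewrite -E -E'; ring.
have [_ h1 _] := H s y' a b; have [_ _ h2] := H y'' s' b' a'.
have -> : f12 p - f21 p = (f12 p - f12 (s, y')) - (f21 p - f21 (y'', s')).
  by rewrite EE; ring.
by apply: (le_trans (ler_normB _ _)); lra.
Qed.

End mean_value.

(** * Closure properties of the classes C^k *)

Section Ck_functions.
Context {R : realType}.
Implicit Types (W : set (R * R)) (f g : R * R -> R) (p z : R * R).

Lemma Ck_onW k W f : Ck_on k.+1 W f -> Ck_on k W f.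
Proof.
elim: k f => [|k ih] f /= [cf [df [c1 c2]]]; first by [].
exact: (conj cf (conj df (conj (ih _ c1) (ih _ c2)))).
Qed.

Lemma Ck_on_subset k W W' f : W' `<=` W -> Ck_on k W f -> Ck_on k W' f.
Proof.
move=> s; elim: k f => [|k ih] f /= [cf].
  by move=> _; split=> // p /s; exact: cf.
move=> [df [c1 c2]]; split; first by move=> p /s; exact: cf.
by split; [move=> p /s; exact: df|split; exact: ih].
Qed.

Lemma Ck_on_C1 W f : Ck_on 1 W f -> C1_on W f ('D_(e1 R) f) ('D_(e2 R) f).
Proof.
move=> /= [cf [df [[c1 _] [c2 _]]]]; split; [exact: cf|exact: c1|exact: c2|move=> p Wp].
by have [? ?] := df p Wp; split; exact: derivableP.
Qed.

Lemma Ck_on_ext k W f g : open W -> (forall p, W p -> f p = g p) ->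
  Ck_on k W f -> Ck_on k W g.
Proof.
move=> oW; have N p : W p -> \forall q \near p, W q.
  by move=> Wp; exact: open_nbhs_nbhs.
elim: k f g => [|k ih] f g E /= [cf].
  move=> _; split=> // p Wp; have := cf p Wp.
  rewrite /prop_for /continuous_at -(E p Wp).
  by apply: cvg_trans; apply: near_eq_cvg; apply: filterS (N p Wp) => q /E.
have Ne p : W p -> \forall q \near p, f q = g q.
  by move=> Wp; apply: filterS (N p Wp) => q /E.
move=> [df [c1 c2]]; split.
  move=> p Wp; have := cf p Wp; rewrite /prop_for /continuous_at -(E p Wp).
  by apply: cvg_trans; apply: near_eq_cvg; exact: Ne.
split.
  by move=> p Wp; have [? ?] := df p Wp; split; apply: near_eq_derivable; try exact: Ne.
by split; [apply: ih c1|apply: ih c2] => p Wp; apply: near_eq_derive; exact: Ne.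
Qed.

Lemma Ck_onD k W f g : open W -> Ck_on k W f -> Ck_on k W g -> Ck_on k W (f + g).
Proof.
move=> oW; elim: k f g => [|k ih] f g /= [cf].
  by move=> _ [cg _]; split; last exact: I; move=> p Wp; apply: continuousD; [exact: cf|exact: cg].
move=> [df [c1 c2]] [cg [dg [c1' c2']]]; split.
  by move=> p Wp; apply: continuousD; [exact: cf|exact: cg].
split.
  move=> p Wp; have [? ?] := df p Wp; have [? ?] := dg p Wp.
  by split; exact: derivableD.
split; [apply: Ck_on_ext (ih _ _ c1 c1') => //|apply: Ck_on_ext (ih _ _ c2 c2') => //];
  by move=> p Wp; have [? ?] := df p Wp; have [? ?] := dg p Wp; rewrite deriveD.
Qed.

Lemma Ck_onN k W f : open W -> Ck_on k W f -> Ck_on k W (- f).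
Proof.
move=> oW; elim: k f => [|k ih] f /= [cf].
  by move=> _; split; last exact: I; move=> p Wp; apply: continuousN; exact: cf.
move=> [df [c1 c2]]; split.
  by move=> p Wp; apply: continuousN; exact: cf.
split.
  by move=> p Wp; have [? ?] := df p Wp; split; exact: derivableN.
split; [apply: Ck_on_ext (ih _ c1) => //|apply: Ck_on_ext (ih _ c2) => //];
  by move=> p Wp; have [? ?] := df p Wp; rewrite deriveN.
Qed.

End Ck_functions.

(** * Pointwise vanishing to a given order *)

Section vanishing_order.
Context {R : realType}.
Implicit Types (W A : set (R * R)) (f g h : R * R -> R) (p z : R * R).

Definition big_O_pow z k f :=
  exists C, \forall p \near z, `|f p| <= C * `|p - z| ^+ k.

Lemma big_O_powP z k f : big_O_pow z k f -> exists C r,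
  [/\ 0 <= C, 0 < r & forall p, `|p - z| < r -> `|f p| <= C * `|p - z| ^+ k].
Proof.
move=> [C /nbhs_ballP[r /= r0 H]]; exists `|C|, r; split=> // p pr.
apply: (@le_trans _ _ (C * `|p - z| ^+ k)).
  by apply: H; rewrite -ball_normE /= -normrN opprB.
by rewrite ler_wpM2r ?exprn_ge0// ler_norm.
Qed.

Lemma big_O_pow_ball z k f C r : 0 < r ->
  (forall p, `|p - z| < r -> `|f p| <= C * `|p - z| ^+ k) -> big_O_pow z k f.
Proof.
move=> r0 H; exists C; apply/nbhs_ballP; exists r => //= p.
by rewrite -ball_normE /= -normrN opprB; exact: H.
Qed.

Lemma big_O_powD z k f g : big_O_pow z k f -> big_O_pow z k g ->
  big_O_pow z k (fun p => f p + g p).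
Proof.
move=> [C Hf] [D Hg]; exists (C + D); near=> p.
rewrite mulrDl; apply: (le_trans (ler_normD _ _)).
by apply: lerD; near: p.
Unshelve. all: by end_near. Qed.

Lemma big_O_powN z k f : big_O_pow z k f -> big_O_pow z k (fun p => - f p).
Proof. by move=> [C Hf]; exists C; near do rewrite normrN. Unshelve. all: by end_near. Qed.

Lemma big_O_pow0 z f : {for z, continuous f} -> big_O_pow z 0 f.
Proof.
move=> cf; exists (`|f z| + 1).
have H : \forall p \near z, `|f z - f p| <= 1.
  by apply: (@cvgrPdist_le _ _ _ _ _ _ _).1 cf _ ltr01.
near=> p; rewrite expr0 mulr1 -lerBlDl.
apply: (@le_trans _ _ `|f z - f p|); last by near: p.
by rewrite distrC; exact: lerB_dist.
Unshelve. all: by end_near. Qed.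

(** The gradient is bounded on the square of radius [|p - z|] by its order [k], and the mean value
    inequality contributes one more factor [|p - z|]. *)
Lemma big_O_pow_primitive W z k f f1 f2 : open W -> W z -> C1_on W f f1 f2 ->
  f z = 0 -> big_O_pow z k f1 -> big_O_pow z k f2 -> big_O_pow z k.+1 f.
Proof.
move=> oW Wz [_ _ _ D] fz /big_O_powP[C [r [C0 r0 H]]] /big_O_powP[C' [r' [C0' r0' H']]].
have /nbhs_ballP[t /= t0 Ht] : nbhs z W by exact: open_nbhs_nbhs.
apply: (@big_O_pow_ball z k.+1 f ((C + C') *+ 2) (Num.min (Num.min r r') t)).
  by rewrite !lt_min r0 r0'.
move=> p; rewrite !lt_min => /andP[/andP[pr pr'] pt].
rewrite -[f p]subr0 -fz exprS mulrCA mulrC.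
rewrite (_ : _ * _ * _ = ((C + C') * `|p - z| ^+ k) *+ 2 * `|p - z|); last first.
  by rewrite -mulrnAl; ring.
apply: (mean_value_square (f1 := f1) (f2 := f2)) => q qp.
  by apply: D; apply: Ht; rewrite -ball_normE /= -normrN opprB (le_lt_trans qp).
have qk : `|q - z| ^+ k <= `|p - z| ^+ k by apply: lerXn2r => //; rewrite nnegrE.
split.
  apply: (le_trans (H q (le_lt_trans qp pr))).
  by apply: ler_pM => //; rewrite ?exprn_ge0// lerDl.
apply: (le_trans (H' q (le_lt_trans qp pr'))).
by apply: ler_pM => //; rewrite ?exprn_ge0// lerDr.
Qed.

Lemma eq0_closure W A z f : open W -> W z -> closure A z ->
  {for z, continuous f} -> (forall p, A p -> W p -> f p = 0) -> f z = 0.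
Proof.
move=> oW Wz cA cf f0; apply/eqP; apply/negP => /negP fz.
have N : \forall p \near z, f p != 0 by exact: (cvgr_neq0 (f z) cf fz).
have [p [Ap [Wp /= ]]] := cA _ (filterI (open_nbhs_nbhs (conj oW Wz)) N).
by rewrite f0// eqxx.
Qed.

(** The derivatives of [f] vanish on the open set [A], hence at [z] by continuity; integrating back
    gains one order per derivative. Applied to the components of [dbar U], it shows that they are
    flat at the boundary point. *)
Lemma big_O_pow_closure k W A z f : open W -> W z -> open A -> closure A z ->
  Ck_on k W f -> (forall p, A p -> W p -> f p = 0) -> big_O_pow z k f.
Proof.
move=> oW Wz oA cA; elim: k f => [|k ih] f Cf f0.
  by apply: big_O_pow0; have [+ _] := Cf; apply.
have CC : C1_on W f ('D_(e1 R) f) ('D_(e2 R) f).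
  by apply: Ck_on_C1; elim: (k) Cf => // m imh /Ck_onW.
have [cf [df [c1 c2]]] := Cf.
have N p v : A p -> W p -> 'D_v f p = 0.
  move=> Ap Wp; rewrite -(derive_cst (0 : R) p v); apply: near_eq_derive.
  have : \forall q \near p, (A `&` W) q.
    by apply: open_nbhs_nbhs; split; [exact: openI|].
  by apply: filterS => q [/f0]; apply.
apply: (big_O_pow_primitive oW Wz CC).
- by apply: (eq0_closure oW Wz cA) => //; exact: cf.
- by apply: ih => // p ? ?; exact: N.
- by apply: ih => // p ? ?; exact: N.
Qed.

End vanishing_order.

(** * Taylor expansion at the boundary point *)

Section taylor.
Context {R : realType}.
Implicit Types (W A : set (R * R)) (f g h : R * R -> R) (p q z : R * R).

(* The j-th power of [q.1 + i q.2], as a pair. *)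
Fixpoint cpow (j : nat) (q : R * R) : R * R :=
  if j is j'.+1 then
    (q.1 * (cpow j' q).1 - q.2 * (cpow j' q).2,
     q.1 * (cpow j' q).2 + q.2 * (cpow j' q).1)
  else (1, 0).

Lemma C1_on_sub W z : C1_on W (fun p => (p - z).1) (fun=> 1) (fun=> 0) /\
  C1_on W (fun p => (p - z).2) (fun=> 0) (fun=> 1).
Proof.
split.
  have := C1_onD (C1_on_fst W) (C1_on_cst W (- z.1)).
  by rewrite addr0 addr0.
have := C1_onD (C1_on_snd W) (C1_on_cst W (- z.2)).
by rewrite addr0 addr0.
Qed.

Lemma C1_on_cpow W z j : open W ->
  C1_on W (fun p => (cpow j.+1 (p - z)).1)
     (fun p => j.+1%:R * (cpow j (p - z)).1) (fun p => - (j.+1%:R * (cpow j (p - z)).2)) /\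
  C1_on W (fun p => (cpow j.+1 (p - z)).2)
     (fun p => j.+1%:R * (cpow j (p - z)).2) (fun p => j.+1%:R * (cpow j (p - z)).1).
Proof.
move=> oW; have [Cx Cy] := C1_on_sub W z; elim: j => [|j [ih1 ih2]].
  split.
    apply: (C1_on_eq (C1_onD (C1_onM Cx (C1_on_cst W 1))
      (C1_onN (C1_onM Cy (C1_on_cst W 0))))) => //= p Wp; ring.
  apply: (C1_on_eq (C1_onD (C1_onM Cx (C1_on_cst W 0))
    (C1_onM Cy (C1_on_cst W 1)))) => //= p Wp; ring.
split.
  apply: (C1_on_eq (C1_onD (C1_onM Cx ih1) (C1_onN (C1_onM Cy ih2)))) => // p Wp.
    by rewrite -!natr1 /=; ring.
  by rewrite -!natr1 /=; ring.
apply: (C1_on_eq (C1_onD (C1_onM Cx ih2) (C1_onM Cy ih1))) => // p Wp.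
  by rewrite -!natr1 /=; ring.
by rewrite -!natr1 /=; ring.
Qed.

Lemma cpow_normE j q :
  (cpow j q).1 ^+ 2 + (cpow j q).2 ^+ 2 = (q.1 ^+ 2 + q.2 ^+ 2) ^+ j.
Proof.
elim: j => [|j ih] /=; first by rewrite expr0 expr1n expr0n addr0.
by rewrite [RHS]exprS -ih; ring.
Qed.

Lemma big_O_pow_ext z k f g : f =1 g -> big_O_pow z k f -> big_O_pow z k g.
Proof. by move=> /funext ->. Qed.

(** The induction passes to the pair of [e1] derivatives, the complex derivative of [f + i h], which
    again satisfies the Cauchy-Riemann equations on [A]. The [e2] derivatives differ from the ones
    so described by [a] and [b], the components of twice [dbar], flat at [z]; integration then
    raises the orders by one. As the first alternative does not involve [k], its failure gives
    flatness to every order. *)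
Lemma smooth_taylor_dichotomy k W A z f h : open W -> W z -> open A -> closure A z ->
  (forall n, Ck_on n W f) -> (forall n, Ck_on n W h) ->
  (forall p, A p -> W p -> 'D_(e1 R) f p = 'D_(e2 R) h p /\
     'D_(e2 R) f p = - 'D_(e1 R) h p) ->
  (exists j c1 c2, [/\ c1 ^+ 2 + c2 ^+ 2 != 0,
    big_O_pow z j.+1 (fun p => f p - (c1 * (cpow j (p - z)).1 - c2 * (cpow j (p - z)).2)) &
    big_O_pow z j.+1 (fun p => h p - (c1 * (cpow j (p - z)).2 + c2 * (cpow j (p - z)).1))])
  \/ (big_O_pow z k f /\ big_O_pow z k h).
Proof.
move=> oW Wz oA cA; elim: k f h => [|k ih] f h Sf Sh CR.
  by right; split; apply: big_O_pow0; [have [+ _] := Sf 0|have [+ _] := Sh 0]; apply.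
have Cf := Ck_on_C1 (Sf 1); have Ch := Ck_on_C1 (Sh 1).
have Sf1 n : Ck_on n W ('D_(e1 R) f) by have [_ [_ []]] := Sf n.+1.
have Sf2 n : Ck_on n W ('D_(e2 R) f) by have [_ [_ []]] := Sf n.+1.
have Sh1 n : Ck_on n W ('D_(e1 R) h) by have [_ [_ []]] := Sh n.+1.
have Sh2 n : Ck_on n W ('D_(e2 R) h) by have [_ [_ []]] := Sh n.+1.
(* A nonzero value at [z] is itself the leading coefficient, of degree 0. *)
have [fh0|fh0] := eqVneq (f z ^+ 2 + h z ^+ 2) 0; last first.
  left; exists 0%N, (f z), (h z); split => //.
    have K := C1_onD Cf (C1_on_cst W (- f z)).
    apply: (big_O_pow_ext (f := fun p => f p - f z)).
      by move=> p /=; ring.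
    apply: (big_O_pow_primitive oW Wz K); first by rewrite subrr.
    - by apply: big_O_pow0; case: K => _ + _ _; apply.
    - by apply: big_O_pow0; case: K => _ _ + _; apply.
  have K := C1_onD Ch (C1_on_cst W (- h z)).
  apply: (big_O_pow_ext (f := fun p => h p - h z)).
    by move=> p /=; ring.
  apply: (big_O_pow_primitive oW Wz K); first by rewrite subrr.
  - by apply: big_O_pow0; case: K => _ + _ _; apply.
  - by apply: big_O_pow0; case: K => _ _ + _; apply.
have [fz hz] : f z = 0 /\ h z = 0.
  move: fh0 => /eqP; rewrite paddr_eq0 ?sqr_ge0// !sqrf_eq0.
  by move=> /andP[/eqP -> /eqP ->].
pose a p := 'D_(e1 R) f p - 'D_(e2 R) h p.
pose b p := 'D_(e2 R) f p + 'D_(e1 R) h p.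
have Fa n : big_O_pow z n a.
  apply: (big_O_pow_closure oW Wz oA cA); last by move=> p Ap Wp; rewrite /a (CR p Ap Wp).1 subrr.
  by apply: Ck_onD => //; apply: Ck_onN.
have Fb n : big_O_pow z n b.
  apply: (big_O_pow_closure oW Wz oA cA); last by move=> p Ap Wp; rewrite /b (CR p Ap Wp).2 addNr.
  exact: Ck_onD.
have CR1 p : A p -> W p -> 'D_(e1 R) ('D_(e1 R) f) p = 'D_(e2 R) ('D_(e1 R) h) p /\
     'D_(e2 R) ('D_(e1 R) f) p = - 'D_(e1 R) ('D_(e1 R) h) p.
  move=> Ap Wp.
  have N : \forall q \near p, (A `&` W) q.
    by apply: open_nbhs_nbhs; split; [exact: openI|].
  have Schw g : (forall n, Ck_on n W g) ->
      'D_(e2 R) ('D_(e1 R) g) p = 'D_(e1 R) ('D_(e2 R) g) p.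
    move=> Sg; have [_ [_ [S1 S2]]] := Sg 2%N.
    exact: (mixed_partials_eq oW (Ck_on_C1 (Sg 1%N)) (Ck_on_C1 S1) (Ck_on_C1 S2) Wp).
  split.
    rewrite (Schw h Sh); apply: near_eq_derive; apply: filterS N => q [Aq Wq].
    exact: (CR q Aq Wq).1.
  have dh : derivable ('D_(e1 R) h) p (e1 R) by have [_ [dh _]] := Sh1 1%N; exact: (dh p Wp).1.
  rewrite (Schw f Sf).
  rewrite -(deriveN dh).
  apply: near_eq_derive; apply: filterS N => q [Aq Wq].
  exact: (CR q Aq Wq).2.
have [[j [c1 [c2 [c0 B1 B2]]]]|[B1 B2]] := ih _ _ Sf1 Sh1 CR1; last first.
  right; split.
    apply: (big_O_pow_primitive oW Wz Cf); [exact: fz|exact: B1|].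
    apply: (big_O_pow_ext (f := fun p => b p - 'D_(e1 R) h p)).
      by move=> p; rewrite /b; ring.
    exact: big_O_powD (Fb k) (big_O_powN B2).
  apply: (big_O_pow_primitive oW Wz Ch); [exact: hz|exact: B2|].
  apply: (big_O_pow_ext (f := fun p => 'D_(e1 R) f p - a p)).
    by move=> p; rewrite /a; ring.
  exact: big_O_powD B1 (big_O_powN (Fa k)).
left; have [Z1 Z2] := C1_on_cpow z j oW.
have j0 : j.+1%:R != 0 :> R by rewrite pnatr_eq0.
(* Integrating the power of degree [j] divides its coefficient by [j + 1]. *)
pose d1 := c1 / j.+1%:R; pose d2 := c2 / j.+1%:R.
have E1 : d1 * j.+1%:R = c1 by rewrite divfK.
have E2 : d2 * j.+1%:R = c2 by rewrite divfK.
exists j.+1, d1, d2; split.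
- rewrite !expr_div_n -mulrDl mulf_neq0// invr_neq0 ?expf_neq0//.
- have K := C1_onD Cf (C1_onN (C1_onD (C1_onM (C1_on_cst W d1) Z1)
      (C1_onN (C1_onM (C1_on_cst W d2) Z2)))).
  apply: (big_O_pow_primitive oW Wz K).
  + by rewrite fz subrr /=; ring.
  + apply: (big_O_pow_ext _ B1) => p /=; rewrite -E1 -E2; ring.
  + apply: (big_O_pow_ext _ (big_O_powD (Fb j.+1) (big_O_powN B2))) => p /=.
    by rewrite /b -E1 -E2; ring.
- have K := C1_onD Ch (C1_onN (C1_onD (C1_onM (C1_on_cst W d1) Z2)
      (C1_onM (C1_on_cst W d2) Z1))).
  apply: (big_O_pow_primitive oW Wz K).
  + by rewrite hz subrr /=; ring.
  + apply: (big_O_pow_ext _ B2) => p /=; rewrite -E1 -E2; ring.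
  + apply: (big_O_pow_ext _ (big_O_powD B1 (big_O_powN (Fa j.+1)))) => p /=.
    by rewrite /a -E1 -E2; ring.
Qed.

End taylor.

(** * Lower bound for [|U|] at a zero of finite order *)

Section finite_order.
Context {R : realType}.
Implicit Types (f h : R * R -> R) (p z : R * R).

Lemma sqr_norm_prod p : `|p| ^+ 2 <= p.1 ^+ 2 + p.2 ^+ 2.
Proof.
rewrite prod_normE /=; case: (leP `|p.1| `|p.2|) => _; rewrite real_normK ?num_real//.
  by rewrite lerDr sqr_ge0.
by rewrite lerDl sqr_ge0.
Qed.

(** The leading term has squared modulus at least [m * (|p - z| ^+ 2) ^+ j]. The inequality
    [a ^+ 2 / 2 - (x - a) ^+ 2 <= x ^+ 2] keeps half of it, and on a small enough ball the remainder
    consumes at most half of that, so [m / 4] is left. *)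
Lemma taylor_lower_bound z f h j c1 c2 : c1 ^+ 2 + c2 ^+ 2 != 0 ->
  big_O_pow z j.+1 (fun p => f p - (c1 * (cpow j (p - z)).1 - c2 * (cpow j (p - z)).2)) ->
  big_O_pow z j.+1 (fun p => h p - (c1 * (cpow j (p - z)).2 + c2 * (cpow j (p - z)).1)) ->
  exists c r, [/\ 0 < c, 0 < r & forall p, `|p - z| < r ->
    c * (`|p - z| ^+ 2) ^+ j <= f p ^+ 2 + h p ^+ 2].
Proof.
move=> c0 /big_O_powP[C [r [C0 r0 H]]] /big_O_powP[C' [r' [C0' r0' H']]].
set m := _ + _ in c0; have m0 : 0 < m by rewrite lt_neqAle eq_sym c0 addr_ge0 ?sqr_ge0.
pose K := C ^+ 2 + C' ^+ 2 + 1.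
have K0 : 0 < K by rewrite ltr_wpDl// addr_ge0 ?sqr_ge0.
have mK : 0 < m / (4 * K) by rewrite divr_gt0// mulr_gt0.
exists (m / 4), (Num.min (Num.min r r') (Num.min 1 (m / (4 * K)))); split.
- by rewrite divr_gt0.
- by rewrite !lt_min r0 r0' ltr01 mK.
move=> p; rewrite !lt_min => /andP[/andP[pr pr'] /andP[p1 pK]].
have {H} := H p pr; have {H'} := H' p pr'.
set A := c1 * _ - _; set B := c1 * _ + _; set rho := `|p - z| in p1 pK *.
have rho0 : 0 <= rho by rewrite /rho.
move=> HB HA; pose t := (rho ^+ 2) ^+ j.
have t0 : 0 <= t by rewrite exprn_ge0 ?sqr_ge0.
have S (D E : R) : 0 <= D -> `|E| <= D * rho ^+ j.+1 -> E ^+ 2 <= D ^+ 2 * (rho ^+ 2 * t).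
  move=> D0 DE; rewrite -[E ^+ 2]real_normK ?num_real//.
  rewrite (_ : _ * _ = (D * rho ^+ j.+1) ^+ 2); last first.
    by rewrite exprMn /t -exprS -!exprM mulnC.
  by apply: lerXn2r => //; rewrite nnegrE ?mulr_ge0 ?exprn_ge0.
have SA := S _ _ C0 HA; have SB := S _ _ C0' HB.
have AB : m * t <= A ^+ 2 + B ^+ 2.
  have -> : A ^+ 2 + B ^+ 2 = m * ((p - z).1 ^+ 2 + (p - z).2 ^+ 2) ^+ j.
    by rewrite -cpow_normE /A /B /m; ring.
  rewrite ler_pM2l// /t; apply: lerXn2r; rewrite ?nnegrE ?addr_ge0 ?sqr_ge0//.
  exact: sqr_norm_prod.
have rK : rho ^+ 2 * K <= m / 4.
  apply: (@le_trans _ _ (rho * K)).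
    by rewrite ler_pM2r// expr2 ler_piMr// ltW.
  by rewrite -ler_pdivlMr// -mulrA -invfM ltW.
have KK : (C ^+ 2 + C' ^+ 2) * (rho ^+ 2 * t) <= m / 4 * t.
  apply: (@le_trans _ _ (K * (rho ^+ 2 * t))).
    by rewrite ler_wpM2r ?mulr_ge0 ?sqr_ge0// lerDl.
  by rewrite mulrA ler_wpM2r// mulrC.
have Ef (x a : R) : a ^+ 2 / 2 - (x - a) ^+ 2 <= x ^+ 2.
  rewrite -subr_ge0 (_ : _ - _ = (2 * x - a) ^+ 2 / 2); last by field.
  by rewrite divr_ge0 ?sqr_ge0.
have := Ef (f p) A; have := Ef (h p) B; rewrite -/t; nra.
Qed.

End finite_order.

(** * Measurability and integrability on squares of the plane *)

Section plane_integration.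
Context {R : realType}.
Implicit Types (W Q : set (R * R)) (f g F : R * R -> R) (p a : R * R).

Local Notation mu := (@lebesgue_measure R).
Local Notation mu2 := ((@lebesgue_measure R \x @lebesgue_measure R)%E).

(** Links the product topology to the product sigma-algebra: [O] is the union of the countably many
    boxes with rational centre and radius that it contains. *)
Lemma open_measurable_plane (O : set (measurableTypeR R * measurableTypeR R)) :
  open (O : set (R * R)) -> measurable O.
Proof.
move=> oO.
pose box (q : rat * rat * rat) : set (R * R) :=
  `]ratr q.1.1 - ratr q.2, ratr q.1.1 + ratr q.2[%classic `*`
  `]ratr q.1.2 - ratr q.2, ratr q.1.2 + ratr q.2[%classic.
pose S q : set (R * R) := [set p | box q p /\ box q `<=` O].
have -> : O = \bigcup_q S q.
  apply/seteqP; split; last by move=> p [q _ [bp]]; apply.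
  move=> p Op; have /nbhs_ballP[r /= r0 H] : nbhs p (O : set (R * R)).
    by apply: open_nbhs_nbhs.
  have [e /andP[e0 er]] : exists e : rat, (0 < ratr e :> R) && (ratr e * 2 <= r).
    have r2 : (0 : R) < r / 2 by rewrite divr_gt0.
    have [e] := rat_in_itvoo r2; rewrite in_itv/= => /andP[e1 e2].
    by exists e; rewrite e1 -ler_pdivlMr// ltW.
  have [x xP] : exists x : rat, `|p.1 - ratr x| < ratr e.
    have [|x] := @rat_in_itvoo _ (p.1 - ratr e) (p.1 + ratr e); first by lra.
    rewrite in_itv/= => xx; exists x; rewrite ltr_norml; lra.
  have [y yP] : exists y : rat, `|p.2 - ratr y| < ratr e.
    have [|y] := @rat_in_itvoo _ (p.2 - ratr e) (p.2 + ratr e); first by lra.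
    rewrite in_itv/= => yy; exists y; rewrite ltr_norml; lra.
  move: xP yP; rewrite !ltr_norml => xP yP.
  exists (x, y, e) => //; split; first by split; rewrite /= in_itv/=; lra.
  move=> q [/=]; rewrite !in_itv/= => q1 q2; apply: H; rewrite -ball_normE /=.
  rewrite prod_normE gt_max /= !ltr_norml; apply/andP; split; lra.
apply: countable_bigcupT_measurable => [|q]; first exact: countableP.
have [sq|nsq] := pselect (box q `<=` O); last first.
  by rewrite (_ : S q = set0)//; apply/seteqP; split=> // p [].
rewrite (_ : S q = box q); last by apply/seteqP; split=> // p [].
by apply: measurableX; exact: measurable_itv.
Qed.

Lemma continuous_on_measurable W (Q : set (measurableTypeR R * measurableTypeR R)) f :
  open W -> measurable Q -> Q `<=` W -> continuous_on W f ->
  measurable_fun Q (f : measurableTypeR R * measurableTypeR R -> measurableTypeR R).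
Proof.
move=> oW mQ QW cf; apply: (measurability _ (measurable_realfun.RGenOpens.measurableE R)).
move=> _ [_ [a [b ->] <-]].
pose B : set R := `]a, b[%classic.
have oE : open (W `&` f @^-1` B).
  rewrite openE => p [Wp Bp]; apply: filterI; first exact: open_nbhs_nbhs.
  by apply: cf => //; apply: open_nbhs_nbhs; split => //; exact: interval_open.
rewrite (_ : Q `&` _ = Q `&` (W `&` f @^-1` B)).
  by apply: measurableI => //; exact: open_measurable_plane.
by apply/seteqP; split=> p [Qp]; [split=> //; split=> //; exact: QW|case=> _; split].
Qed.

Definition square a r : set (R * R) :=
  `[a.1 - r, a.1 + r]%classic `*` `[a.2 - r, a.2 + r]%classic.

Lemma squareP a r p : square a r p <-> `|p - a| <= r.
Proof.
rewrite norm_prod_le /square /= !in_itv/= !ler_norml; split.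
  by move=> [h1 h2]; apply/andP; split; lra.
by move=> /andP[h1 h2]; split; lra.
Qed.

Lemma square_measurable a r :
  measurable (square a r : set (measurableTypeR R * measurableTypeR R)).
Proof. by apply: measurableX; exact: measurable_itv. Qed.

Lemma square_measure a r : 0 < r -> mu2 (square a r) = (4 * r ^+ 2)%:E.
Proof.
move=> r0.
have E (b : R) : mu `[b - r, b + r]%classic = (2 * r)%:E.
  rewrite lebesgue_measure_itv /= lte_fin ifT; last by lra.
  by rewrite -EFinB; congr EFin; ring.
transitivity ((2 * r)%:E * (2 * r)%:E)%E; last by rewrite -EFinM; congr EFin; ring.
rewrite -{1}(E a.1) -(E a.2); apply: product_measure1E; exact: measurable_itv.
Qed.

Lemma continuous_on_bounded W a r f : open W -> square a r `<=` W ->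
  continuous_on W f -> exists M, forall p, square a r p -> `|f p| <= M.
Proof.
move=> oW sW cf.
have cpt : compact (f @` square a r).
  apply: continuous_compact.
    by apply: continuous_in_subspaceT => p /[!inE] /sW; exact: cf.
  by apply: compact_setX; exact: segment_compact.
have [M [_ HM]] := compact_bounded cpt.
exists (M + 1) => p sp; apply: (HM (M + 1)); last by exists p.
by rewrite ltrDl.
Qed.

Lemma continuous_on_integrable W a r f : open W -> 0 < r -> square a r `<=` W ->
  continuous_on W f -> mu2.-integrable (square a r) (EFin \o f).
Proof.
move=> oW r0 sW cf; apply: measurable_bounded_integrable.
- exact: square_measurable.
- by rewrite [X in (X < _)%E](square_measure _ r0) ltry.
- exact: continuous_on_measurable (square_measurable a r) sW cf.
- have [M HM] := continuous_on_bounded oW sW cf.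
  exists M; split; first exact: num_real.
  by move=> x Mx p /HM /le_trans; apply; exact: ltW.
Qed.

End plane_integration.

(** * The divergence theorem on a square, used as an inequality *)

Section divergence.
Context {R : realType}.
Implicit Types (W : set (R * R)) (f g F : R * R -> R) (p a : R * R).

Local Notation mu := (@lebesgue_measure R).
Local Notation mu2 := ((@lebesgue_measure R \x @lebesgue_measure R)%E).

Lemma integral_derive_vanishing (g dg : R -> R) (b r : R) : 0 < r ->
  (forall t, `|t - b| <= r -> is_derive t (1 : R) g (dg t)) ->
  (forall t, `|t - b| <= r -> {for t, continuous dg}) ->
  g (b - r) = 0 -> g (b + r) = 0 ->
  (\int[mu]_(t in `[(b - r)%R, (b + r)%R]) (dg t)%:E)%E = 0%E.
Proof.
move=> r0 Dg Cg gl gr.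
have I t : t \in `[b - r, b + r] -> `|t - b| <= r.
  by rewrite in_itv/= ler_norml => /andP[? ?]; apply/andP; split; lra.
have cg t : `|t - b| <= r -> {for t, continuous g}.
  move=> /Dg[d _]; apply: differentiable_continuous; exact/derivable1_diffP.
have nl : `|b - r - b| <= r by rewrite addrAC subrr add0r normrN ger0_norm// ltW.
have nr : `|b + r - b| <= r by rewrite addrAC subrr add0r ger0_norm// ltW.
rewrite (@continuous_FTC2 _ dg g); first by rewrite gl gr subee.
- by lra.
- by apply: continuous_in_subspaceT => t /[!inE] /I; exact: Cg.
- split.
  + by move=> t tI; have [] := Dg t (I t (subset_itv_oo_cc tI)).
  + exact: cvg_at_right_filter (cg _ nl).
  + exact: cvg_at_left_filter (cg _ nr).
- move=> t tI; have [_ <-] := Dg t (I t (subset_itv_oo_cc tI)).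
  exact: derive1E.
Qed.

(** By Fubini, the integral is taken along horizontal segments first; on each one the fundamental
    theorem of calculus leaves a difference of end values, both 0. *)
Lemma integral_partial1_square W a r F F1 : open W -> 0 < r -> square a r `<=` W ->
  continuous_on W F1 -> (forall p, W p -> is_derive p (e1 R) F (F1 p)) ->
  (forall p, square a r p -> `|p.1 - a.1| = r -> F p = 0) ->
  (\int[mu2]_(p in square a r) (F1 p)%:E)%E = 0%E.
Proof.
move=> oW r0 sW cF D F0.
have iF := continuous_on_integrable oW r0 sW cF.
rewrite integral_mkcond -integral21_prod_meas1; last first.
  exact/(integrable_mkcond _ (square_measurable a r)).
rewrite (_ : fubini_G _ _ = cst 0%E) ?integral_cst ?mul0e//.
apply/funext => y; rewrite /fubini_G /=.
have [yI|yI] := pselect (`[a.2 - r, a.2 + r]%classic y); last first.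
  apply: integral0_eq => x _; rewrite patchE ifF//.
  by apply/negP => /set_mem[].
have yr : `|y - a.2| <= r.
  by move: yI; rewrite /= in_itv/= ler_norml => /andP[? ?]; apply/andP; split; lra.
have Wx x : `|x - a.1| <= r -> W (x, y).
  by move=> xr; apply: sW; apply/squareP; rewrite norm_prod_le /= xr yr.
rewrite -[RHS](@integral_derive_vanishing (fun x => F (x, y)) (fun x => F1 (x, y)) a.1 r r0).
- rewrite [RHS]integral_mkcond; apply: eq_integral => x _; rewrite !patchE.
  congr (if _ then _ else _); apply/idP/idP => /set_mem H; apply/mem_set; last by split.
  by case: H.
- by move=> x xr; apply/(is_derive_slice1 F (x, y)); apply: D; exact: Wx.
- move=> x xr; apply: (@continuous_comp _ _ _ (fun x => (x, y)) F1).
    by apply: (@cvg_pair _ _ _ (nbhs x) (nbhs x) (nbhs y)); [exact: cvg_id|exact: cvg_cst].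
  by apply: cF; exact: Wx.
- apply: F0; last by rewrite /= addrAC subrr add0r normrN gtr0_norm.
  by apply/squareP; rewrite norm_prod_le /= addrAC subrr add0r normrN (gtr0_norm r0) ?lexx ?yr.
- apply: F0; last by rewrite /= addrAC subrr add0r gtr0_norm.
  by apply/squareP; rewrite norm_prod_le /= addrAC subrr add0r (gtr0_norm r0) ?lexx ?yr.
Qed.

Lemma integral_partial2_square W a r F F2 : open W -> 0 < r -> square a r `<=` W ->
  continuous_on W F2 -> (forall p, W p -> is_derive p (e2 R) F (F2 p)) ->
  (forall p, square a r p -> `|p.2 - a.2| = r -> F p = 0) ->
  (\int[mu2]_(p in square a r) (F2 p)%:E)%E = 0%E.
Proof.
move=> oW r0 sW cF D F0.
have iF := continuous_on_integrable oW r0 sW cF.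
rewrite integral_mkcond -integral12_prod_meas1; last first.
  exact/(integrable_mkcond _ (square_measurable a r)).
rewrite (_ : fubini_F _ _ = cst 0%E) ?integral_cst ?mul0e//.
apply/funext => x; rewrite /fubini_F /=.
have [xI|xI] := pselect (`[a.1 - r, a.1 + r]%classic x); last first.
  apply: integral0_eq => y _; rewrite patchE ifF//.
  by apply/negP => /set_mem[].
have xr : `|x - a.1| <= r.
  by move: xI; rewrite /= in_itv/= ler_norml => /andP[? ?]; apply/andP; split; lra.
have Wx y : `|y - a.2| <= r -> W (x, y).
  by move=> yr; apply: sW; apply/squareP; rewrite norm_prod_le /= xr yr.
rewrite -[RHS](@integral_derive_vanishing (fun y => F (x, y)) (fun y => F2 (x, y)) a.2 r r0).
- rewrite [RHS]integral_mkcond; apply: eq_integral => y _; rewrite !patchE.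
  congr (if _ then _ else _); apply/idP/idP => /set_mem H; apply/mem_set; last by split.
  by case: H.
- by move=> y yr; apply/(is_derive_slice2 F (x, y)); apply: D; exact: Wx.
- move=> y yr; apply: (@continuous_comp _ _ _ (fun y => (x, y)) F2).
    by apply: (@cvg_pair _ _ _ (nbhs y) (nbhs x) (nbhs y)); [exact: cvg_cst|exact: cvg_id].
  by apply: cF; exact: Wx.
- apply: F0; last by rewrite /= addrAC subrr add0r normrN gtr0_norm.
  by apply/squareP; rewrite norm_prod_le /= addrAC subrr add0r normrN (gtr0_norm r0) ?lexx ?xr.
- apply: F0; last by rewrite /= addrAC subrr add0r gtr0_norm.
  by apply/squareP; rewrite norm_prod_le /= addrAC subrr add0r (gtr0_norm r0) ?lexx ?xr.
Qed.

(* [(F, G)] has zero flux through the boundary of the big square. *)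
Lemma divergence_square_bound W a b r e F G F1 F2 G1 G2 (V : R * R -> R) C1 C2 k :
  open W -> 0 < r -> 0 < e -> square a r `<=` W -> square b e `<=` square a r ->
  C1_on W F F1 F2 -> C1_on W G G1 G2 ->
  (forall p, square a r p -> `|p.1 - a.1| = r -> F p = 0) ->
  (forall p, square a r p -> `|p.2 - a.2| = r -> G p = 0) ->
  mu2.-integrable (square a r) (EFin \o V) ->
  (forall p, square a r p -> F1 p + G2 p + k * \1_(square b e) p <= C1 + C2 * V p) ->
  k * (4 * e ^+ 2) <= C1 * (4 * r ^+ 2) + C2 * (\int[mu2]_(p in square a r) V p)%R.
Proof.
move=> oW r0 e0 sW ba [_ cF1 _ DF] [_ _ cG2 DG] F0 G0 iV H.
have mS := square_measurable a r.
have iF := continuous_on_integrable oW r0 sW cF1.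
have iG := continuous_on_integrable oW r0 sW cG2.
have I1 := integral_partial1_square oW r0 sW cF1 (fun p Wp => (DF p Wp).1) F0.
have I2 := integral_partial2_square oW r0 sW cG2 (fun p Wp => (DG p Wp).2) G0.
have iC c : mu2.-integrable (square a r) (EFin \o (fun=> c)).
  by apply: (@continuous_on_integrable R W a r (fun=> c) oW r0 sW); exact: continuous_on_cst.
have iE : mu2.-integrable (square a r) (EFin \o (\1_(square b e) : _ -> R)).
  apply: measurable_bounded_integrable => //.
  - by rewrite [X in (X < _)%E](square_measure _ r0) ltry.
  - by apply: measurable_realfun.measurable_indic; exact: square_measurable.
  - exists 1; split; first exact: num_real.
    move=> x x1 p _ /=; rewrite indicE; case: (_ \in _); rewrite ?normr1 ?normr0 ltW//.
    exact: lt_trans x1.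
have iFG : mu2.-integrable (square a r) (EFin \o (fun p => F1 p + G2 p)).
  by apply: eq_integrable (integrableD mS iF iG) => // p _; rewrite /= EFinD.
have iK : mu2.-integrable (square a r) (EFin \o (fun p => k * \1_(square b e) p)).
  by apply: eq_integrable (integrableZl mS k iE) => // p _; rewrite /= EFinM.
have iCV : mu2.-integrable (square a r) (EFin \o (fun p => C2 * V p)).
  by apply: eq_integrable (integrableZl mS C2 iV) => // p _; rewrite /= EFinM.
have iL : mu2.-integrable (square a r)
    (EFin \o (fun p => F1 p + G2 p + k * \1_(square b e) p)).
  by apply: eq_integrable (integrableD mS iFG iK) => // p _; rewrite /= EFinD.
have iR : mu2.-integrable (square a r) (EFin \o (fun p => C1 + C2 * V p)).
  by apply: eq_integrable (integrableD mS (iC C1) iCV) => // p _; rewrite /= EFinD.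
have := le_Rintegral mS iL iR H.
rewrite (RintegralD mS iFG iK) (RintegralD mS iF iG) (RintegralD mS (iC C1) iCV).
rewrite (RintegralZl _ mS iE) (RintegralZl _ mS iV).
rewrite /Rintegral I1 I2 integral_indic//; last exact: square_measurable.
rewrite setIidl// integral_cst//=.
rewrite (_ : mu2 (square b e) = (4 * e ^+ 2)%:E); last exact: square_measure.
rewrite (_ : mu2 (square a r) = (4 * r ^+ 2)%:E); last exact: square_measure.
by rewrite /= !add0r.
Qed.

End divergence.

(** * The flux field and the bound on its divergence *)

Section log_flux.
Context {R : realType}.

(* Young's inequality absorbs the cross term [X . grad w] into
   [T |grad w|^2], as [T <= -1]; the Jacobian [fx hy - hx fy] is at least
   [- D / 4]. *)
Lemma log_flux_ineq (f h fx fy hx hy d T m wx wy Lw : R) :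
  let s := f ^+ 2 + h ^+ 2 in
  let D := (fx - hy) ^+ 2 + (hx + fy) ^+ 2 in
  let u := (s ^+ 2 + d ^+ 2)^-1 in
  let X1 := s * u * (f * (fx - hy) + h * (hx + fy)) in
  let X2 := s * u * (f * (hx + fy) - h * (fx - hy)) in
  0 < d -> T <= -1 -> 0 <= m ->
  T * (3 * m ^+ 2 * Lw + 6 * m * (wx ^+ 2 + wy ^+ 2))
   + 3 * m ^+ 2 * (X1 * wx + X2 * wy)
   - m ^+ 3 * (4 * (fx * hy - hx * fy) * s * d ^+ 2 * u ^+ 2)
  <= 3 * m ^+ 2 * (T * Lw) + m ^+ 3 * (D / s).
Proof.
move=> s D u X1 X2 d0 T1 m0.
have g0 : 0 <= wx ^+ 2 + wy ^+ 2 by rewrite addr_ge0 ?sqr_ge0.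
have s0 : 0 <= s by rewrite addr_ge0 ?sqr_ge0.
have D0 : 0 <= D by rewrite addr_ge0 ?sqr_ge0.
have m3 : 0 <= m ^+ 3 by rewrite exprn_ge0.
have Tg : T * (6 * m * (wx ^+ 2 + wy ^+ 2)) <= - (6 * m * (wx ^+ 2 + wy ^+ 2)).
  by rewrite -mulN1r ler_wpM2r// !mulr_ge0.
(* Completing the square with weight [1 / 4] spends exactly the term [6 * m * |grad w| ^+ 2] that
   [T <= -1] supplies; [3 / 8] is what remains. The cube makes the powers match: [m ^+ 2] is the
   geometric mean of [m] and [m ^+ 3]. *)
have AM : 3 * m ^+ 2 * (X1 * wx + X2 * wy) <=
    6 * m * (wx ^+ 2 + wy ^+ 2) + m ^+ 3 * (3 / 8 * (X1 ^+ 2 + X2 ^+ 2)).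
  rewrite -subr_ge0 (_ : _ - _ =
    6 * m * ((wx - m * X1 / 4) ^+ 2 + (wy - m * X2 / 4) ^+ 2)); last by field.
  by rewrite !mulr_ge0 ?addr_ge0 ?sqr_ge0.
have J : - (4 * (fx * hy - hx * fy) * s * d ^+ 2 * u ^+ 2) <= D * s * (d ^+ 2 * u ^+ 2).
  rewrite -subr_ge0 (_ : _ - _ =
    ((fx + hy) ^+ 2 + (hx - fy) ^+ 2) * s * (d ^+ 2 * u ^+ 2)); last by rewrite /D; ring.
  apply: mulr_ge0; last by rewrite mulr_ge0 ?sqr_ge0.
  by rewrite mulr_ge0// addr_ge0 ?sqr_ge0.
have XX : X1 ^+ 2 + X2 ^+ 2 = D * s * (s * u) ^+ 2 by rewrite /X1 /X2 /D /s; ring.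
(* For [s > 0] this says [3 / 8 * A ^+ 2 + A * B <= 1] with [A + B = 1]. For [s = 0] both sides are
   0, the left one through its factor [s]. *)
have K : 3 / 8 * (X1 ^+ 2 + X2 ^+ 2) + D * s * (d ^+ 2 * u ^+ 2) <= D / s.
  rewrite XX; have [->|sn0] := eqVneq s 0.
    by rewrite !(mulr0, mul0r, invr0, addr0).
  have sp : 0 < s by rewrite lt_neqAle eq_sym sn0.
  rewrite ler_pdivlMr//.
  have den : s ^+ 2 + d ^+ 2 != 0.
    by rewrite gt_eqF// ltr_pwDl ?exprn_gt0// sqr_ge0.
  pose A := s ^+ 2 * u; pose B := d ^+ 2 * u.
  have AB : A + B = 1 by rewrite /A /B -mulrDl mulfV.
  have u0 : 0 <= u by rewrite invr_ge0 addr_ge0 ?sqr_ge0.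
  have A0 : 0 <= A by rewrite mulr_ge0 ?sqr_ge0.
  have B0 : 0 <= B by rewrite mulr_ge0 ?sqr_ge0.
  rewrite [leLHS](_ : _ = D * (3 / 8 * A ^+ 2 + A * B)); last by rewrite /A /B; ring.
  rewrite -[leRHS]mulr1 ler_wpM2l//.
  have -> : B = 1 - A by rewrite -AB addrC addrA addNr add0r.
  nra.
have := ler_wpM2l m3 J; have := ler_wpM2l m3 K; lra.
Qed.

(** With [P = m ^+ 3] and [(A, B)] the regularised gradient of [arg U], the field is
    [T * grad P + P * (- B, A)]. Its divergence consists of [T] times the Laplacian of [P], the
    product of [grad P] with [grad T + (- B, A)], and [- P] times the curl of [(A, B)]. The vector
    [grad T + (- B, A)] vanishes where the Cauchy-Riemann equations hold, so it is controlled by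
    [dbar U]. Symmetry of the second derivatives clears the curl of second-order terms. *)
Lemma log_flux (W : set (R * R)) (f fx fy fxx fxy fyx fyy h hx hy hxx hxy hyx hyy
   w wx wy wxx wxy wyx wyy : R * R -> R) (d c : R) :
  let s p := f p ^+ 2 + h p ^+ 2 in
  let T p := ln (s p ^+ 2 + d ^+ 2) / 4 - c in
  let m p := Num.max (w p) 0 in
  open W -> 0 < d ->
  C1_on W f fx fy -> C1_on W fx fxx fxy -> C1_on W fy fyx fyy ->
  C1_on W h hx hy -> C1_on W hx hxx hxy -> C1_on W hy hyx hyy ->
  C1_on W w wx wy -> C1_on W wx wxx wxy -> C1_on W wy wyx wyy ->
  exists F G F1 F2 G1 G2, [/\ C1_on W F F1 F2, C1_on W G G1 G2,
    forall p, w p <= 0 -> F p = 0 /\ G p = 0 &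
    forall p, W p -> T p <= -1 -> F1 p + G2 p <=
      3 * m p ^+ 2 * (T p * (wxx p + wyy p)) + m p ^+ 3 *
        (((fx p - hy p) ^+ 2 + (hx p + fy p) ^+ 2) / s p)].
Proof.
move=> s T m oW d0 Cf Cfx Cfy Ch Chx Chy Cw Cwx Cwy.
have Ef := mixed_partials_eq oW Cf Cfx Cfy.
have Eh := mixed_partials_eq oW Ch Chx Chy.
have Cs := C1_onD (C1_onM Cf Cf) (C1_onM Ch Ch).
have Cn := C1_onD (C1_onM Cs Cs) (C1_on_cst W (d ^+ 2)).
have n0 p : W p -> 0 < (f p * f p + h p * h p) * (f p * f p + h p * h p) + d ^+ 2.
  by move=> _; rewrite ltr_wpDl ?exprn_gt0// -expr2 sqr_ge0.
have CT := C1_onD (C1_onM (C1_on_ln Cn n0) (C1_on_cst W 4^-1)) (C1_on_cst W (- c)).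
have Cu := C1_onV Cn (fun p Wp => lt0r_neq0 (n0 p Wp)).
have Cq := C1_onM Cs Cu.
have CB := C1_onM (C1_onD (C1_onM Cf Chy) (C1_onN (C1_onM Ch Cfy))) Cq.
have CA := C1_onM (C1_onD (C1_onM Cf Chx) (C1_onN (C1_onM Ch Cfx))) Cq.
have CP := C1_on_max0X 1 Cw.
have CPx := C1_onM (C1_onM (C1_on_cst W 3) (C1_on_max0X 0 Cw)) Cwx.
have CPy := C1_onM (C1_onM (C1_on_cst W 3) (C1_on_max0X 0 Cw)) Cwy.
have CF := C1_onD (C1_onM CT CPx) (C1_onN (C1_onM CP CB)).
have CG := C1_onD (C1_onM CT CPy) (C1_onM CP CA).
do 6 eexists; split; [exact: CF|exact: CG| |].
  by move=> p wp /=; rewrite (max_r wp) !expr0n /= !(mul0r, mulr0, addr0, subrr).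
move=> p Wp Tp /=.
apply: le_trans (@log_flux_ineq (f p) (h p) (fx p) (fy p) (hx p) (hy p) d (T p) (m p)
  (wx p) (wy p) (wxx p + wyy p) d0 Tp _); last by rewrite le_max lexx orbT.
rewrite (Ef p Wp) (Eh p Wp) le_eqVlt; apply/orP; left; apply/eqP.
rewrite /T /s -/(m p); set mm := m p.
rewrite -!expr2; set l := ln _; set N := (_ ^+ 2 + d ^+ 2).
have N0 : N != 0 by rewrite lt0r_neq0// /N expr2 !expr2 -(expr2 d) n0.
have -> : d ^+ 2 = N - (f p ^+ 2 + h p ^+ 2) ^+ 2 by rewrite /N; ring.
clearbody N l mm; field; exact: N0.
Qed.

End log_flux.

(** * The subharmonic comparison function *)

Section barrier.
Context {R : realType}.
Implicit Types (W : set (R * R)) (p a z : R * R).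

Definition dist2 p a : R := (p - a).1 ^+ 2 + (p - a).2 ^+ 2.

Lemma dist2_ge0 p a : 0 <= dist2 p a.
Proof. by rewrite addr_ge0 ?sqr_ge0. Qed.

(* Subharmonic where [rho ^ 2 <= dist2 p a]; the logarithm contributes a
   Laplacian of mass of order [lam] concentrated at scale [e] near [z]. *)
Definition barrier a z (rho c lam e : R) p : R :=
  (dist2 p a + rho ^+ 2)^-1 - c + lam * (ln (dist2 p z + e ^+ 2) / 2).

Lemma dist2D_gt0 p a (d : R) : 0 < d -> 0 < dist2 p a + d ^+ 2.
Proof. by move=> d0; rewrite ltr_wpDl ?dist2_ge0// exprn_gt0. Qed.

Lemma C1_on_dist2D W a (d : R) : open W -> C1_on W (fun p => dist2 p a + d ^+ 2)
  (fun p => 2 * (p - a).1) (fun p => 2 * (p - a).2).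
Proof.
move=> oW; have [Cx Cy] := C1_on_sub W a.
by apply: (C1_on_eq (C1_onD (C1_onD (C1_onM Cx Cx) (C1_onM Cy Cy))
  (C1_on_cst W (d ^+ 2)))) => // p Wp /=; ring.
Qed.

Lemma barrier_laplacian W a z (rho c lam e : R) : open W -> 0 < rho -> 0 < e ->
  exists w1 w2 w11 w12 w21 w22 : R * R -> R,
  [/\ C1_on W (barrier a z rho c lam e) w1 w2, C1_on W w1 w11 w12, C1_on W w2 w21 w22 &
   forall p, W p -> w11 p + w22 p = 4 * (dist2 p a - rho ^+ 2) / (dist2 p a + rho ^+ 2) ^+ 3
      + lam * (2 * e ^+ 2 / (dist2 p z + e ^+ 2) ^+ 2)].
Proof.
move=> oW rho0 e0.
have Ca := C1_on_dist2D a rho oW; have Cz := C1_on_dist2D z e oW.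
have [Cax Cay] := C1_on_sub W a; have [Czx Czy] := C1_on_sub W z.
have na p : W p -> dist2 p a + rho ^+ 2 != 0 by move=> _; rewrite gt_eqF// dist2D_gt0.
have nz p : W p -> dist2 p z + e ^+ 2 != 0 by move=> _; rewrite gt_eqF// dist2D_gt0.
have Va := C1_onV Ca na; have Vz := C1_onV Cz nz.
have Lz := C1_on_ln Cz (fun p _ => dist2D_gt0 p z e0).
have Cw := C1_onD (C1_onD Va (C1_on_cst W (- c)))
  (C1_onM (C1_on_cst W lam) (C1_onM Lz (C1_on_cst W 2^-1))).
have Cw' : C1_on W (barrier a z rho c lam e)
   (fun p => - ((dist2 p a + rho ^+ 2)^-1 * (dist2 p a + rho ^+ 2)^-1) * (2 * (p - a).1)
      + lam * ((dist2 p z + e ^+ 2)^-1 * (p - z).1))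
   (fun p => - ((dist2 p a + rho ^+ 2)^-1 * (dist2 p a + rho ^+ 2)^-1) * (2 * (p - a).2)
      + lam * ((dist2 p z + e ^+ 2)^-1 * (p - z).2)).
  apply: (C1_on_eq Cw) => // p Wp /=; have := na p Wp; have := nz p Wp => h1 h2;
  by field; rewrite ?h1 ?h2.
have C1 := C1_onD (C1_onM (C1_onN (C1_onM Va Va)) (C1_onM (C1_on_cst W 2) Cax))
  (C1_onM (C1_on_cst W lam) (C1_onM Vz Czx)).
have C2 := C1_onD (C1_onM (C1_onN (C1_onM Va Va)) (C1_onM (C1_on_cst W 2) Cay))
  (C1_onM (C1_on_cst W lam) (C1_onM Vz Czy)).
do 6 eexists; split; [exact: Cw'|exact: C1|exact: C2|].
move=> p Wp; have := na p Wp; have := nz p Wp; rewrite /dist2 /= => h1 h2.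
by field; rewrite h1 h2.
Qed.

End barrier.

(** * The quantitative form of unique continuation *)

Section unique_continuation_estimate.
Context {R : realType}.
Implicit Types (p a z : R * R).

Local Notation mu2 := ((@lebesgue_measure R \x @lebesgue_measure R)%E).

Lemma dist2_norm_le p a : dist2 p a <= 2 * `|p - a| ^+ 2.
Proof.
have /andP[h1 h2] : (`|(p - a).1| <= `|p - a|) && (`|(p - a).2| <= `|p - a|).
  by rewrite -norm_prod_le.
rewrite /dist2 mulr2n mulrDl !mul1r; apply: lerD; rewrite -real_normK ?num_real//.
  by apply: lerXn2r; rewrite ?nnegrE.
by apply: lerXn2r; rewrite ?nnegrE.
Qed.

(** Here [le] is [ln (1 / e)]: it multiplies the bound on [- T], divides the bound on the Laplacian,
    and cancels. The constant is [3 * (1 / 16) * (1 / 4) * (1 / 4) * (2 / 9) = 1 / 384]. *)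
Lemma log_flux_near_zero (N c0 le e m T Lw : R) :
  0 < c0 -> 0 < e -> 0 < le -> 0 <= N -> c0 / 4 <= m -> T <= - (N * le / 4) ->
  c0 / (4 * le) * (2 / (9 * e ^+ 2)) <= Lw ->
  3 * m ^+ 2 * (T * Lw) <= - (N * c0 ^+ 3 / (384 * e ^+ 2)).
Proof.
move=> c00 e0 le0 N0 hm hT hL.
set K := c0 / (4 * le) * _ in hL.
have K0 : 0 < K by rewrite mulr_gt0// divr_gt0// mulr_gt0// exprn_gt0.
have t0 : 0 <= N * le / 4 by rewrite divr_ge0// mulr_ge0// ltW.
have TL : N * le / 4 * K <= - (T * Lw).
  rewrite -mulNr; apply: ler_pM => //; first exact: ltW.
  by rewrite lerNr.
have mm : 3 * (c0 / 4) ^+ 2 <= 3 * m ^+ 2.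
  have c4 : 0 <= c0 / 4 by rewrite divr_ge0 // ltW.
  by rewrite ler_pM2l//; apply: lerXn2r; rewrite // nnegrE// (le_trans c4).
rewrite -lerN2 opprK -mulrN.
apply: le_trans (ler_pM _ _ mm TL); last 2 first.
- by rewrite mulr_ge0// sqr_ge0.
- by rewrite mulr_ge0// ltW.
rewrite /K le_eqVlt; apply/orP; left; apply/eqP; field.
by rewrite !gt_eqF.
Qed.

(** With [P = rho ^+ 2] and [t] the squared distance to [a], the worst case is the centre [t = 0],
    where equality holds. *)
Lemma barrier_laplacian_ge (t P : R) : 0 <= t -> 0 < P ->
  - (4 / P ^+ 2) <= 4 * (t - P) / (t + P) ^+ 3.
Proof.
move=> t0 P0; have tP : 0 < t + P by rewrite ltr_wpDl.
rewrite ler_pdivlMr ?exprn_gt0// mulNr lerNl -mulrN opprB.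
rewrite mulrAC -[X in _ <= X]mulrA ler_pM2l// ler_pdivlMr ?exprn_gt0//.
apply: (@le_trans _ _ (P ^+ 3)).
  by rewrite [leRHS]exprSr [leRHS]mulrC ler_pM2r ?exprn_gt0// gerBl.
by apply: lerXn2r; rewrite ?nnegrE ?(ltW P0) ?(ltW tP)// lerDr.
Qed.

(** Three regions of the square are distinguished. On the [e]-square about [z], the product of [T]
    and the Laplacian is at most [- k]. Within distance [rho] of [a] the Laplacian may be negative,
    but [s0 <= s] bounds [T], at the price of the first summand on the right. Elsewhere [T] and the
    Laplacian have opposite signs. The integral of [V] pays for [dbar U]. *)
Lemma unique_continuation_bound W a z (r rho e c0 s0 S d : R) (N : nat)
  (f fx fy fxx fxy fyx fyy h hx hy hxx hxy hyx hyy : R * R -> R) :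
  let s p := f p ^+ 2 + h p ^+ 2 in
  let V p := ((fx p - hy p) ^+ 2 + (hx p + fy p) ^+ 2) / s p in
  let c := ln S / 4 + 1 in
  open W -> square a r `<=` W -> 0 < r -> r <= 1 / 4 -> 0 < rho -> 0 < c0 -> 1 <= S ->
  C1_on W f fx fy -> C1_on W fx fxx fxy -> C1_on W fy fyx fyy ->
  C1_on W h hx hy -> C1_on W hx hxx hxy -> C1_on W hy hyx hyy ->
  mu2.-integrable (square a r) (EFin \o V) ->
  0 < s0 -> (forall p, square a r p -> dist2 p a < rho ^+ 2 -> s0 <= s p) ->
  0 < d -> (forall p, square a r p -> s p ^+ 2 + d ^+ 2 <= S) ->
  0 < e -> e ^+ 2 <= 1 / 2 -> square z e `<=` square a r ->
  (forall p, square z e p -> [/\ (r ^+ 2 + rho ^+ 2)^-1 + c0 / 2 <= (dist2 p a + rho ^+ 2)^-1,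
      rho ^+ 2 <= dist2 p a & s p ^+ 2 + d ^+ 2 <= e ^+ N]) ->
  N%:R * c0 ^+ 3 / 96 <=
   3 * (rho ^+ 2)^-1 ^+ 2 * (`|ln (s0 ^+ 2) / 4 - c| * (4 / (rho ^+ 2) ^+ 2)) * (4 * r ^+ 2)
   + (rho ^+ 2)^-1 ^+ 3 * (\int[mu2]_(p in square a r) V p)%R.
Proof.
move=> s V c oW sW r0 r4 rho0 c00 S1 Cf Cfx Cfy Ch Chx Chy iV s00 Hs0 d0 HS e0 e2 Ea HE.
have e1 : e < 1 by nra.
have le0 : 0 < - ln e by rewrite oppr_gt0 ln_lt0// e0.
(* On the [e]-square the logarithmic term is at least [lam * ln e = - (c0 / 4)], which leaves
   [c0 / 4] of the margin [c0 / 2] granted by [HE]. *)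
pose lam := c0 / (4 * - ln e).
have lam0 : 0 < lam by rewrite divr_gt0// mulr_gt0.
(* This is the value of the first summand of the barrier at Euclidean distance [r] from [a]. The
   sides of the square are at least that far, so the barrier is nonpositive there and the flux field
   vanishes. *)
pose c1 := (r ^+ 2 + rho ^+ 2)^-1.
have [wx [wy [wxx [wxy [wyx [wyy [Cw Cwx Cwy Lw]]]]]]] :=
  barrier_laplacian a z c1 lam oW rho0 e0.
have [F [G [F1 [F2 [G1 [G2 [CF CG FG0 FG]]]]]]] :=
  log_flux c oW d0 Cf Cfx Cfy Ch Chx Chy Cw Cwx Cwy.
set w := barrier a z rho c1 lam e in Cw FG FG0.
have rho2 : 0 < rho ^+ 2 by rewrite exprn_gt0.
have V0 p : 0 <= V p by rewrite divr_ge0// addr_ge0 ?sqr_ge0.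
have zs : square a r z by apply: Ea; apply/squareP; rewrite subrr normr0 ltW.
(* The bounds [r <= 1 / 4] and [e ^+ 2 <= 1 / 2] serve here: each of the two summands is at most
   [1 / 2]. *)
have Lz p : square a r p -> ln (dist2 p z + e ^+ 2) <= 0.
  move=> sp; apply: ln_le0.
  have pz : `|p - z| <= 1 / 2.
    have -> : p - z = (p - a) - (z - a) by rewrite opprB addrA subrK.
    apply: (le_trans (ler_normB _ _)); move: sp zs => /squareP sp /squareP zs; lra.
  have := dist2_norm_le p z; have : `|p - z| ^+ 2 <= (1 / 2) ^+ 2.
    by apply: lerXn2r; rewrite ?nnegrE.
  lra.
have wle p : square a r p -> w p <= (dist2 p a + rho ^+ 2)^-1 - c1.
  by move=> sp; rewrite /w /barrier gerDl; have := Lz p sp; nra.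
have w0 p : square a r p -> `|p - a| = r -> w p <= 0.
  move=> sp pr; apply: (le_trans (wle p sp)); rewrite subr_le0 lef_pV2 ?posrE.
  - by rewrite lerD2r -pr; exact: sqr_norm_prod.
  - exact: dist2D_gt0.
  - by rewrite addr_gt0// exprn_gt0.
have wM p : square a r p -> w p <= (rho ^+ 2)^-1.
  move=> sp; apply: (le_trans (wle p sp)).
  apply: (@le_trans _ _ (dist2 p a + rho ^+ 2)^-1).
    by rewrite gerBl /c1 invr_ge0 ltW// addr_gt0// exprn_gt0.
  by rewrite lef_pV2 ?posrE ?dist2D_gt0// lerDr dist2_ge0.
have bd (p : R * R) : square a r p -> (`|p.1 - a.1| = r \/ `|p.2 - a.2| = r) -> `|p - a| = r.
  move=> /squareP pa H; apply/eqP; rewrite eq_le pa /=.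
  have /andP[h1 h2] : (`|(p - a).1| <= `|p - a|) && (`|(p - a).2| <= `|p - a|).
    by rewrite -norm_prod_le.
  by case: H => <-.
(* Times the area [4 * e ^+ 2] of the square about [z], this density loses its dependence on [e]. *)
pose k := N%:R * c0 ^+ 3 / (384 * e ^+ 2).
have -> : N%:R * c0 ^+ 3 / 96 = k * (4 * e ^+ 2).
  by rewrite /k; field; rewrite gt_eqF.
have c0' : 0 <= c by rewrite addr_ge0// divr_ge0// ln_ge0.
apply: (divergence_square_bound oW r0 e0 sW Ea CF CG _ _ iV).
- by move=> p sp pr; apply: (FG0 p _).1; apply: w0 => //; apply: bd => //; left.
- by move=> p sp pr; apply: (FG0 p _).2; apply: w0 => //; apply: bd => //; right.
move=> p sp; have Wp := sW p sp.
have Sp : 0 < s p ^+ 2 + d ^+ 2 by rewrite ltr_wpDl ?sqr_ge0// exprn_gt0.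
(* The two terms of [c] have this purpose: [ln S / 4] makes the difference nonpositive and the 1
   gives the room that Young's inequality needs. *)
have Tp : ln (s p ^+ 2 + d ^+ 2) / 4 - c <= -1.
  rewrite /c opprD addrA gerDr subr_le0 ler_pM2r// ler_ln ?posrE ?HS//.
  by rewrite (lt_le_trans Sp) ?HS.
have {FG} := FG p Wp Tp; rewrite -/(s p) -/(V p).
set T := ln _ / 4 - c in Tp *; set m := Num.max (w p) 0; set L := wxx p + wyy p.
have m0 : 0 <= m by rewrite le_max lexx orbT.
have mM : m <= (rho ^+ 2)^-1 by rewrite ge_max; apply/andP; split; [exact: wM|rewrite invr_ge0 ltW].
have mV : m ^+ 3 * V p <= (rho ^+ 2)^-1 ^+ 3 * V p.
  by rewrite ler_wpM2r//; apply: lerXn2r; rewrite ?nnegrE// invr_ge0 ltW.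
have Lz0 : 0 <= lam * (2 * e ^+ 2 / (dist2 p z + e ^+ 2) ^+ 2).
  by rewrite mulr_ge0 ?(ltW lam0)// divr_ge0 ?sqr_ge0// mulr_ge0 ?sqr_ge0.
set C1 := 3 * (rho ^+ 2)^-1 ^+ 2 * _.
have C10 : 0 <= C1.
  by rewrite /C1 !mulr_ge0 ?normr_ge0 ?invr_ge0 ?sqr_ge0.
suff H : 3 * m ^+ 2 * (T * L) + k * \1_(square z e) p <= C1 by lra.
have LE := Lw p Wp; rewrite -/L in LE.
have [Ep|Ep] := pselect (square z e p).
  have [h1 h2 h3] := HE p Ep.
  rewrite indicE mem_set// mulr1.
  suff : 3 * m ^+ 2 * (T * L) <= - k by lra.
  have dz : dist2 p z + e ^+ 2 <= 3 * e ^+ 2.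
    have := dist2_norm_le p z; move/squareP: Ep => Ep.
    have : `|p - z| ^+ 2 <= e ^+ 2 by apply: lerXn2r; rewrite ?nnegrE// ltW.
    lra.
  apply: (@log_flux_near_zero N%:R c0 (- ln e) e m T L) => //.
  - rewrite le_max; apply/orP; left; rewrite /w /barrier.
    have lnle : ln (e ^+ 2) <= ln (dist2 p z + e ^+ 2).
      by rewrite ler_ln ?posrE ?exprn_gt0 ?dist2D_gt0// lerDr dist2_ge0.
    rewrite lnXn// in lnle.
    have E1 : lam * (ln e *+ 2 / 2) = - (c0 / 4).
      rewrite /lam; field; rewrite lt_eqF// -oppr_gt0//.
    have : lam * (ln e *+ 2 / 2) <= lam * (ln (dist2 p z + e ^+ 2) / 2).
      by rewrite ler_pM2l// ler_pM2r.
    rewrite E1; move: h1; rewrite -/c1; lra.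
  - have : ln (s p ^+ 2 + d ^+ 2) <= ln (e ^+ N).
      by rewrite ler_ln ?posrE// exprn_gt0.
    rewrite lnXn// -mulr_natl => hl.
    rewrite /T; lra.
  - rewrite LE.
    have t1 : 0 <= 4 * (dist2 p a - rho ^+ 2) / (dist2 p a + rho ^+ 2) ^+ 3.
      by rewrite divr_ge0 ?exprn_ge0 ?mulr_ge0 ?subr_ge0// ltW// dist2D_gt0.
    have t2 : 2 / (9 * e ^+ 2) <= 2 * e ^+ 2 / (dist2 p z + e ^+ 2) ^+ 2.
      have -> : 2 / (9 * e ^+ 2) = 2 * e ^+ 2 / (3 * e ^+ 2) ^+ 2.
        by field; rewrite gt_eqF.
      rewrite ler_pM2l ?mulr_gt0 ?exprn_gt0//.
      rewrite lef_pV2 ?posrE ?exprn_gt0 ?mulr_gt0 ?dist2D_gt0 ?exprn_gt0//.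
      by apply: lerXn2r; rewrite ?nnegrE ?(ltW (dist2D_gt0 _ _ e0))// mulr_ge0 ?sqr_ge0.
    have := ler_wpM2l (ltW lam0) t2; rewrite -/lam; lra.
rewrite indicE memNset// mulr0 addr0.
have Tn : T <= 0 by lra.
have m20 : 0 <= 3 * m ^+ 2 by rewrite mulr_ge0 ?sqr_ge0.
have [hr|hr] := lerP (rho ^+ 2) (dist2 p a).
  apply: le_trans C10; rewrite mulr_ge0_le0// mulr_le0_ge0// LE addr_ge0//.
  by rewrite divr_ge0 ?exprn_ge0 ?mulr_ge0 ?subr_ge0// ltW// dist2D_gt0.
rewrite /C1; apply: (@le_trans _ _
  (3 * m ^+ 2 * (`|ln (s0 ^+ 2) / 4 - c| * (4 / (rho ^+ 2) ^+ 2)))).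
  apply: ler_wpM2l => //.
  have LL : - L <= 4 / (rho ^+ 2) ^+ 2.
    have := @barrier_laplacian_ge (dist2 p a) (rho ^+ 2) (dist2_ge0 _ _) rho2.
    by rewrite LE; lra.
  have TT : - T <= `|ln (s0 ^+ 2) / 4 - c|.
    rewrite -normrN; apply: le_trans (ler_norm _); rewrite lerN2 /T lerD2r ler_pM2r//.
    rewrite ler_ln ?posrE ?exprn_gt0//.
    apply: (@le_trans _ _ (s p ^+ 2)); last by rewrite lerDl sqr_ge0.
    by apply: lerXn2r; rewrite ?nnegrE ?(ltW s00)// ?Hs0//; rewrite addr_ge0 ?sqr_ge0.
  rewrite -mulrNN.
  have [Ln|Lp] := lerP 0 L.
    apply: (@le_trans _ _ 0); first by rewrite mulr_ge0_le0 ?oppr_ge0 ?oppr_le0.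
    by rewrite mulr_ge0 ?normr_ge0 ?divr_ge0 ?sqr_ge0.
  by apply: ler_pM; rewrite ?oppr_ge0 // ltW.
apply: ler_wpM2r; first by rewrite mulr_ge0 ?normr_ge0 ?divr_ge0 ?sqr_ge0.
by rewrite ler_pM2l//; apply: lerXn2r; rewrite ?nnegrE// invr_ge0 ltW.
Qed.

End unique_continuation_estimate.

(** * Unique continuation from a zero of infinite order *)

Section unique_continuation.
Context {R : realType}.
Implicit Types (W : set (R * R)) (p a z : R * R) (f h : R * R -> R).

Local Notation mu2 := ((@lebesgue_measure R \x @lebesgue_measure R)%E).

Definition dbar2 f h p : R :=
  ('D_(e1 R) f p - 'D_(e2 R) h p) ^+ 2 + ('D_(e1 R) h p + 'D_(e2 R) f p) ^+ 2.

Lemma dist2_continuous a : continuous (dist2 ^~ a : R * R -> R).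
Proof.
have [Cx Cy] := C1_on_sub setT a.
have [c _ _ _] := C1_onD (C1_onM Cx Cx) (C1_onM Cy Cy).
by move=> p; exact: (c p I).
Qed.

Lemma big_O_pow_eq0 z f : big_O_pow z 1 f -> f z = 0.
Proof.
move=> /big_O_powP[C [r [_ r0 H]]]; apply/eqP; rewrite -normr_le0.
by have := H z; rewrite subrr normr0 expr1 mulr0; apply.
Qed.

(** The order of choices matters: [rho], [c0] and [S] come from [U], [a] and [z] alone and fix the
    bound [B]; then [N] is chosen to exceed what [B] allows; only then is [e] taken small, depending
    on [N] through the flatness at [z]. *)
Lemma unique_continuation W a z r f h : open W -> square a r `<=` W ->
  0 < r -> r <= 1 / 4 -> Ck_on 2 W f -> Ck_on 2 W h ->
  mu2.-integrable (square a r)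
    (EFin \o (fun p => dbar2 f h p / (f p ^+ 2 + h p ^+ 2))) ->
  (forall k, big_O_pow z k f) -> (forall k, big_O_pow z k h) ->
  dist2 z a < r ^+ 2 -> f a ^+ 2 + h a ^+ 2 = 0.
Proof.
move=> oW sW r0 r4 Kf Kh iV Of Oh za; apply/eqP; apply/negP => /negP sa.
pose s p := f p ^+ 2 + h p ^+ 2.
have [_ [_ [Kf1 Kf2]]] := Kf; have [_ [_ [Kh1 Kh2]]] := Kh.
have Cf := Ck_on_C1 (Ck_onW Kf); have Ch := Ck_on_C1 (Ck_onW Kh).
have [cs _ _ _] := C1_onD (C1_onM Cf Cf) (C1_onM Ch Ch).
have sa0 : 0 < s a by rewrite lt_neqAle eq_sym sa addr_ge0 ?sqr_ge0.
have sz : s z = 0 by rewrite /s (big_O_pow_eq0 (Of 1%N)) (big_O_pow_eq0 (Oh 1%N)) expr0n addr0.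
have Wa : W a by apply: sW; apply/squareP; rewrite subrr normr0 ltW.
have /nbhs_ballP[t /= t0 Ht] : \forall p \near a, s a / 2 < s p.
  by apply: (cvgr_gt _ (cs a Wa)); rewrite ltr_pdivrMr// ltr_pMr// ltr1n.
have Hs p : `|p - a| < t -> s a / 2 <= s p.
  by move=> pt; apply: ltW; apply: Ht; rewrite -ball_normE /= -normrN opprB.
(* Since [U] vanishes at [z], this point lies outside the ball on which [s] is bounded below, hence
   in the region where the barrier is subharmonic. *)
have tz : t <= `|z - a|.
  rewrite leNgt; apply/negP => /Hs; rewrite sz leNgt => /negP; apply.
  by rewrite divr_gt0.
pose rho := t / 2.
have rho0 : 0 < rho by rewrite divr_gt0.
have rhot : rho < t by rewrite ltr_pdivrMr// ltr_pMr// ltr1n.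
have rhoz : rho ^+ 2 < dist2 z a.
  apply: lt_le_trans (sqr_norm_prod _); apply: (@lt_le_trans _ _ (t ^+ 2)).
    by rewrite ltr_sqr// nnegrE ltW.
  by apply: lerXn2r; rewrite ?nnegrE// ltW.
pose c0 := (dist2 z a + rho ^+ 2)^-1 - (r ^+ 2 + rho ^+ 2)^-1.
have c00 : 0 < c0.
  rewrite subr_gt0 ltf_pV2 ?posrE ?dist2D_gt0//; last by rewrite addr_gt0// exprn_gt0.
  by rewrite ltrD2r.
have [M HM] := continuous_on_bounded oW sW cs.
pose S := M ^+ 2 + 1.
have S1 : 1 <= S by rewrite lerDr sqr_ge0.
pose B := 3 * (rho ^+ 2)^-1 ^+ 2 * (`|ln ((s a / 2) ^+ 2) / 4 - (ln S / 4 + 1)| *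
    (4 / (rho ^+ 2) ^+ 2)) * (4 * r ^+ 2)
   + (rho ^+ 2)^-1 ^+ 3 * (\int[mu2]_(p in square a r) (dbar2 f h p / s p))%R.
have [N hN] : exists N : nat, B < N%:R * c0 ^+ 3 / 96.
  exists (Num.bound `|B / (c0 ^+ 3 / 96)|).
  rewrite -mulrA -ltr_pdivrMr; last by rewrite divr_gt0// exprn_gt0.
  by apply: le_lt_trans (ler_norm _) _; apply: archi_boundP.
suff : N%:R * c0 ^+ 3 / 96 <= B by rewrite leNgt hN.
(* One order beyond [N] is requested: the spare factor [e] absorbs [C] and [C'] through
   [D * e <= 1 / 2]. *)
have /big_O_powP[C [t1 [C0 t10 H1]]] := Of N.+1.
have /big_O_powP[C' [t2 [C0' t20 H2]]] := Oh N.+1.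
have /nbhs_ballP[t3 /= t30 H3] : \forall p \near z, rho ^+ 2 < dist2 p a.
  by apply: (cvgr_gt _ (@dist2_continuous a z)).
have ez0 : dist2 z a + rho ^+ 2 != 0 by rewrite gt_eqF// dist2D_gt0.
have cV : {for z, continuous (fun p => (dist2 p a + rho ^+ 2)^-1)}.
  apply: continuousV => //; apply: continuousD; last exact: cvg_cst.
  exact: dist2_continuous.
have /nbhs_ballP[t4 /= t40 H4] : \forall p \near z,
    (r ^+ 2 + rho ^+ 2)^-1 + c0 / 2 < (dist2 p a + rho ^+ 2)^-1.
  apply: (cvgr_gt _ cV); by move: c00; rewrite /c0; clear; lra.
have zr : `|z - a| < r.
  rewrite -ltr_sqr ?nnegrE ?(ltW r0)//; exact: (le_lt_trans (sqr_norm_prod _) za).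
pose D := C + C' + 1.
have D0 : 0 < D by rewrite ltr_wpDl// addr_ge0.
have CD : C <= D by rewrite /D -addrA lerDl addr_ge0.
have CD' : C' <= D by rewrite /D addrAC lerDr addr_ge0.
clearbody D.
pose e := Num.min (Num.min (Num.min t1 t2) (Num.min t3 t4))
  (Num.min (r - `|z - a|) (Num.min 1 D^-1)) / 2.
have e0 : 0 < e.
  by rewrite /e divr_gt0// !lt_min t10 t20 t30 t40 subr_gt0 zr ltr01 invr_gt0 D0.
have [[e1 e2 e3 e4] [er e12 eD]] : [/\ e < t1, e < t2, e < t3 & e < t4] /\
    [/\ e <= r - `|z - a|, e <= 1 / 2 & e <= D^-1 / 2].
  have : 2 * e <= Num.min (Num.min (Num.min t1 t2) (Num.min t3 t4))
    (Num.min (r - `|z - a|) (Num.min 1 D^-1)) by rewrite /e mulrC divfK.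
  have lt2 (u : R) : 2 * e <= u -> e < u by move: e0; clear; lra.
  have le2 (u : R) : 2 * e <= u -> e <= u / 2 by clear; lra.
  rewrite !le_min => /andP[/andP[/andP[l1 l2] /andP[l3 l4]] /andP[l5 /andP[l6 l7]]].
  by split; split; [exact: lt2|exact: lt2|exact: lt2|exact: lt2
    |exact/ltW/lt2|exact: le2|exact: le2].
clearbody e.
have e11 : e <= 1 by move: e12; clear; lra.
have e22 : e ^+ 2 <= 1 / 4 by move: e0 e12; clear; nra.
have De : D * e <= 1 / 2.
  by rewrite mulrC -ler_pdivlMr//; move: eD; clear; lra.
pose y := e ^+ N.
have y0 : 0 < y by rewrite exprn_gt0.
have y1 : y <= 1 by apply: exprn_ile1; [exact: ltW|exact: e11].
(* The regularisation [d = e * e ^+ N] is as small as [U] near [z], so that it does not spoil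
   [s ^+ 2 + d ^+ 2 <= e ^+ N]; also [d <= 1], which is why [S = M ^+ 2 + 1] does not depend on
   it. *)
apply: (@unique_continuation_bound R W a z r rho e c0 (s a / 2) S (e * y) N
   f _ _ _ _ _ _ h _ _ _ _ _ _ oW sW r0 r4 rho0 c00 S1 Cf (Ck_on_C1 Kf1) (Ck_on_C1 Kf2)
   Ch (Ck_on_C1 Kh1) (Ck_on_C1 Kh2) iV) => //.
- by rewrite divr_gt0.
- move=> p _ pa; apply: Hs; apply: lt_trans rhot.
  rewrite -ltr_sqr ?nnegrE ?(ltW rho0)//.
  exact: (le_lt_trans (sqr_norm_prod _) pa).
- by rewrite mulr_gt0.
- move=> p /HM; rewrite -!expr2 -/(s p) => sM; rewrite /S; apply: lerD.
    by rewrite -[leLHS]real_normK ?num_real//; apply: lerXn2r; rewrite ?nnegrE// (le_trans _ sM).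
  by apply: exprn_ile1; [rewrite mulr_ge0// ltW|exact: (mulr_ile1 (ltW e0) (ltW y0))].
- by apply: le_trans e22 _; move: e0; clear; lra.
- move=> p /squareP pz; apply/squareP.
  rewrite -[p](subrK z) -addrA; apply: (le_trans (ler_normD _ _)).
  by rewrite -lerBrDr; apply: le_trans pz _.
move=> p /squareP pz.
have bz (u : R) : e < u -> ball z u p.
  by move=> eu; rewrite -ball_normE /= -normrN opprB; exact: le_lt_trans eu.
split; [by apply: ltW; exact: H4 (bz _ e4)|by apply: ltW; exact: H3 (bz _ e3)|].
have ee (u c : R) : 0 <= c -> c <= D -> `|u| <= c * `|p - z| ^+ N.+1 -> u ^+ 2 <= y ^+ 2 / 4.
  move=> cc0 cD uc; rewrite -real_normK ?num_real//.
  rewrite (_ : y ^+ 2 / 4 = (1 / 2 * y) ^+ 2); last by field.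
  apply: lerXn2r; rewrite ?nnegrE ?mulr_ge0 ?(ltW y0)//.
  apply: (le_trans uc); apply: (@le_trans _ _ (c * e ^+ N.+1)).
    by rewrite ler_wpM2l//; apply: lerXn2r; rewrite ?nnegrE// ltW.
  rewrite exprS mulrA ler_wpM2r ?(ltW y0)//; apply: le_trans De.
  by rewrite ler_pM2r.
have f2 : f p ^+ 2 <= y ^+ 2 / 4.
  by apply: (ee _ C C0 CD); apply: H1; exact: le_lt_trans e1.
have h2 : h p ^+ 2 <= y ^+ 2 / 4.
  by apply: (ee _ C' C0' CD'); apply: H2; exact: le_lt_trans e2.
have y2 : y ^+ 2 <= y by rewrite expr2 ler_piMr// ltW.
have ss : (f p ^+ 2 + h p ^+ 2) ^+ 2 <= y / 4.
  apply: (@le_trans _ _ ((y / 2) ^+ 2)); last by move: y2; clear; lra.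
  by apply: lerXn2r; rewrite ?nnegrE ?addr_ge0 ?sqr_ge0 ?divr_ge0 ?(ltW y0)//;
    move: f2 h2 y2; clear; lra.
have ey : (e * y) ^+ 2 <= y / 4.
  by rewrite exprMn; apply: le_trans (ler_pM _ _ e22 y2) _; rewrite ?sqr_ge0// mulrC mulrA mulr1.
by rewrite -/y; move: ss ey y0; clear; lra.
Qed.

End unique_continuation.

(** * Passage between [Lfun] and square-integrability on squares *)

Section local_Lp.
Context {R : realType}.
Implicit Types (W : set (R * R)) (q : R * R -> R) (a : R * R).

Local Notation mu2 := ((@lebesgue_measure R \x @lebesgue_measure R)%E).

Lemma square_restrict_integrable W q (a : R * R) (r K : R) : open W -> 0 < r ->
  W `<=` square a r ->
  measurable_fun (W : set (measurableTypeR R * measurableTypeR R)) q ->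
  (forall p, W p -> `|q p| <= K) ->
  mu2.-integrable setT (EFin \o (fun p => (q \_ W) p ^+ 2)).
Proof.
move=> oW r0 Wa mq qK.
have mW : measurable (W : set (measurableTypeR R * measurableTypeR R)).
  exact: open_measurable_plane.
have E : EFin \o (fun p => (q \_ W) p ^+ 2) = (EFin \o (fun p => q p ^+ 2)) \_ W.
  apply/funext => p /=; rewrite !patchE; case: ifP => // _.
  by rewrite expr0n.
rewrite E; apply/(integrable_mkcond _ mW).
apply: measurable_bounded_integrable => //.
- apply: (@le_lt_trans _ _ (mu2 (square a r))).
    by apply: le_measure => //; rewrite inE//; exact: square_measurable.
  by rewrite [X in (X < _)%E](square_measure _ r0) ltry.
- exact: measurable_funX.
- exists (K ^+ 2); split; first exact: num_real.
  move=> x Kx p Wp /=; apply: le_trans (ltW Kx); rewrite normrX.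
  have K0 : 0 <= K by apply: le_trans (qK p Wp).
  by apply: lerXn2r; rewrite ?nnegrE//; exact: qK.
Qed.

(** One bound serves both exponents, as [W] lies in a square of finite measure. *)
Lemma bounded_Lfun W q (a : R * R) (r K : R) : open W -> 0 < r -> W `<=` square a r ->
  measurable_fun (W : set (measurableTypeR R * measurableTypeR R)) q ->
  (forall p, W p -> `|q p| <= K) ->
  (q \_ W) \in Lfun (@lebesgue2 R) 2%:E /\ (q \_ W) \in Lfun (@lebesgue2 R) +oo%E.
Proof.
move=> oW r0 Wa mq qK.
have mW : measurable (W : set (measurableTypeR R * measurableTypeR R)).
  exact: open_measurable_plane.
have mr : measurable_fun (setT : set (measurableTypeR R * measurableTypeR R)) (q \_ W).
  by apply/(measurable_restrictT _ mW).
have iq := square_restrict_integrable oW r0 Wa mq qK.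
split; rewrite inE; apply/andP; split; rewrite inE//=.
  rewrite /finite_norm unlock poweR_lty//.
  have /integrableP[_] := iq; apply: le_lt_trans.
  rewrite le_eqVlt; apply/orP; left; apply/eqP; apply: eq_integral => p _ /=.
  rewrite normrX; congr EFin.
  by rewrite powR_mulrn.
rewrite /finite_norm unlock; case: ifPn => // _.
apply: (@le_lt_trans _ _ (`|K|)%:E); last exact: ltry.
apply/ess_supP; apply/nearW => p /=; rewrite lee_fin patchE.
case: ifP => [/set_mem Wp|_]; last by rewrite normr0.
by apply: (le_trans (qK p Wp)); exact: ler_norm.
Qed.

Lemma Lfun2_square_integrable W q (a : R * R) (r : R) : open W -> 0 < r ->
  square a r `<=` W -> (q \_ W) \in Lfun (@lebesgue2 R) 2%:E ->
  mu2.-integrable (square a r) (EFin \o (fun p => q p ^+ 2)).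
Proof.
move=> oW r0 aW /Lfun2_integrable_sqr iq.
have := integrableS (measurableT) (square_measurable a r) (@subsetT _ _) iq.
apply: eq_integrable; first exact: square_measurable.
by move=> p /set_mem ap; rewrite /= patchE mem_set//; exact: aW.
Qed.

Lemma Lfuny_square_integrable W q (a : R * R) (r : R) : open W -> 0 < r ->
  square a r `<=` W -> (q \_ W) \in Lfun (@lebesgue2 R) +oo%E ->
  mu2.-integrable (square a r) (EFin \o (fun p => q p ^+ 2)).
Proof.
move=> oW r0 aW; rewrite inE => /andP[]; rewrite !inE /= => mq.
rewrite /finite_norm unlock.
have mS := square_measurable a r.
(* The norm for the exponent [+oo] is the essential supremum only on a space of positive measure. *)
have muT : (0 < lebesgue2 (R := R) setT)%E.
  apply: (@lt_le_trans _ _ (mu2 (square a r))).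
    by rewrite [ltRHS](square_measure _ r0) lte_fin mulr_gt0// exprn_gt0.
  by apply: le_measure; rewrite ?inE.
rewrite muT => fin.
pose g := q \_ W.
have sqM (M : R) p : (`|(g p)%:E| <= M%:E)%E -> (`|(g p ^+ 2)%:E| <= (M ^+ 2)%:E)%E.
  rewrite /= !lee_fin => gM; rewrite normrX; apply: lerXn2r; rewrite ?nnegrE//.
  exact: le_trans gM.
have [M HM] : exists M : R, {ae mu2, forall p, square a r p ->
    (`|(g p ^+ 2)%:E| <= (M ^+ 2)%:E)%E}.
  set m := ess_sup _ _ in fin.
  have := ess_sup_ge mu2 (abse \o (EFin \o g)).
  rewrite -/m; case: m fin => [M _ H|//|_ H].
    by exists M; apply: filterS H => p /= Hp _; exact: sqM.
  exists 0; apply: filterS H => p /= Hp _; apply: sqM.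
  by move: Hp; rewrite leeNy_eq.
have mgS : measurable_fun (square a r : set (measurableTypeR R * measurableTypeR R)) g.
  exact: measurable_funTS.
have iM : mu2.-integrable (square a r) (cst (M ^+ 2)%:E).
  apply/integrableP; split; first exact: measurable_cst.
  rewrite integral_cst// [X in (_ * X)%E](_ : _ = (4 * r ^+ 2)%:E) ?ltry//.
  exact: square_measure.
have : mu2.-integrable (square a r) (EFin \o (fun p => g p ^+ 2)).
  apply/integrableP; split.
    by apply/measurable_EFinP; exact: measurable_funX.
  apply: (@le_lt_trans _ _ (\int[mu2]_(x in square a r) (M ^+ 2)%:E)%E).
    apply: ae_ge0_le_integral => //.
    - apply: measurableT_comp => //; apply/measurable_EFinP; exact: measurable_funX.
    - by move=> x _; rewrite lee_fin sqr_ge0.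
  by rewrite integral_cst// [X in (_ * X)%E](_ : _ = (4 * r ^+ 2)%:E) ?ltry//;
    exact: square_measure.
apply: eq_integrable => // p /set_mem ap.
by rewrite /g /= patchE mem_set//; exact: aW.
Qed.

End local_Lp.

(** * Transfer between [R[i]] and [R * R], and the Cauchy-Riemann equations *)

Section complex_plane.
Context {R : realType}.
Implicit Types (z w : R[i]^o) (p q : R * R) (O : set R[i]^o).

Lemma coordsK : cancel (@plane R) (@coords R).
Proof. by case. Qed.

Lemma planeK : cancel (@coords R) (@plane R).
Proof. by case. Qed.

Lemma normcE2 z : Normc.normc z = Num.sqrt (complex.Re z ^+ 2 + complex.Im z ^+ 2).
Proof. by case: z. Qed.

Lemma ball_planeE z (r : R) : 0 < r ->
  @plane R @^-1` ball z r%:C = [set p | dist2 p (coords z) < r ^+ 2].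
Proof.
move=> r0; apply/seteqP.
suff H p : (@plane R @^-1` ball z r%:C) p <-> dist2 p (coords z) < r ^+ 2.
  by split=> p /H.
rewrite -ball_normE /preimage /= normc_def ltcR.
have -> : complex.Re (z - plane p) ^+ 2 + complex.Im (z - plane p) ^+ 2
    = dist2 p (coords z).
  by case: z => x y; rewrite /dist2 /=; ring.
by rewrite -ltr_sqr ?nnegrE ?sqrtr_ge0 ?(ltW r0)// sqr_sqrtr ?dist2_ge0.
Qed.

(** The order of [R[i]] compares only numbers with equal imaginary parts, so the radius of a ball is
    real. *)
Lemma complex_gt0 (e : R[i]) : 0 < e -> exists2 r : R, 0 < r & e = r%:C.
Proof.
by case: e => x y; rewrite ltcE /= => /andP[/eqP -> x0]; exists x.
Qed.

Lemma plane_open O : open O -> open (@plane R @^-1` O).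
Proof.
rewrite !openE => oO p /oO /nbhs_ballP[_ /= /complex_gt0[r r0 ->] H].
apply/nbhs_ballP; exists (r / 2) => /=; first by rewrite divr_gt0.
move=> q; rewrite -ball_normE /= => pq; apply: H.
suff : (@plane R @^-1` ball (plane p) r%:C) q by [].
rewrite ball_planeE// coordsK /=; apply: (le_lt_trans (dist2_norm_le _ _)).
rewrite -normrN opprB; have : `|p - q| ^+ 2 <= (r / 2) ^+ 2.
  by apply: lerXn2r; rewrite ?nnegrE ?divr_ge0// ltW.
have : 0 < r ^+ 2 by rewrite exprn_gt0.
lra.
Qed.

Lemma coords_open (S : set (R * R)) : open S -> open (@coords R @^-1` S : set R[i]^o).
Proof.
rewrite !openE => oS z /oS /nbhs_ballP[r /= r0 H].
apply/nbhs_ballP; exists r%:C => /=; first by rewrite ltcR.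
move=> w zw; apply: H; rewrite -ball_normE /= -normrN opprB.
rewrite -ltr_sqr ?nnegrE ?(ltW r0)//.
apply: le_lt_trans (sqr_norm_prod _) _.
have : (@plane R @^-1` ball z r%:C) (coords w) by rewrite /preimage /= planeK.
by rewrite ball_planeE.
Qed.

Lemma coords_continuous : continuous (@coords R : R[i]^o -> R * R).
Proof. by apply/continuousP => S /coords_open. Qed.

Lemma plane_continuous : continuous (@plane R : R * R -> R[i]^o).
Proof. by apply/continuousP => O /plane_open. Qed.

Lemma near_plane z (P : set R[i]^o) : (\forall w \near z, P w) ->
  \forall p \near coords z, P (plane p).
Proof.
move=> /nbhs_ballP[_ /= /complex_gt0[r r0 ->] H].
have r0' : (0 : R[i]) < r%:C by rewrite ltcR.
have oB := plane_open (ball_open z r%:C).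
have Bz : (@plane R @^-1` ball z r%:C) (coords z) by rewrite /preimage /= planeK; exact: ballxx.
by apply: filterS (open_nbhs_nbhs (conj oB Bz)) => p /H.
Qed.

(** The complex difference quotient is followed along [t] and along [i t]. Its one limit [l] gives
    the [e1] derivatives in the first case and, after division by [i], the [e2] derivatives in the
    second. *)
Lemma cauchy_riemann (u U : R[i]^o -> R[i]^o) z : derivable u z 1 ->
  (\forall w \near z, U w = u w) ->
  'D_(e1 R) (re_part U) (coords z) = 'D_(e2 R) (im_part U) (coords z) /\
  'D_(e2 R) (re_part U) (coords z) = - 'D_(e1 R) (im_part U) (coords z).
Proof.
move=> du /near_plane uU.
have reE : \forall p \near coords z, re_part U p = re_part u p.
  by apply: filterS uU => p; rewrite /re_part => ->.
have imE : \forall p \near coords z, im_part U p = im_part u p.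
  by apply: filterS uU => p; rewrite /im_part => ->.
rewrite !(near_eq_derive _ reE) !(near_eq_derive _ imE).
move: du => /cvg_ex[l Hl].
have F (k : R -> R[i]^o) : (forall t, t != 0 -> k t != 0) ->
    k t @[t --> (0 : R)] --> (0 : R[i]^o) ->
    coords ((k t)^-1 * (u (k t + z) - u z)) @[t --> (0 : R)^'] --> coords l.
  move=> k0 kc; apply: (@cvg_comp _ _ _ (fun t => (k t)^-1 * (u (k t + z) - u z)) (@coords R)
    _ (nbhs l)); last exact: coords_continuous.
  have kd : k t @[t --> (0 : R)^'] --> (0 : R[i]^o)^'.
    move=> A HA; have HB : nbhs (0 : R) [set t | k t != 0 -> A (k t)] := kc _ HA.
    change (nbhs (0 : R) [set t | t != 0 -> A (k t)]).
    by apply: filterS HB => t Ht /k0; exact: Ht.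
  have := cvg_comp _ _ kd Hl; apply: cvg_trans; apply: near_eq_cvg.
  near=> t; rewrite /= [k t *: 1]mulr1 //.
have c1 : t%:C @[t --> (0 : R)] --> (0 : R[i]^o).
  apply: (@continuous_comp _ _ _ (fun t : R => (t, 0 : R)) (@plane R) 0).
    by apply: (@cvg_pair _ _ _ (nbhs (0 : R)) (nbhs (0 : R)) (nbhs (0 : R)));
      [exact: cvg_id|exact: cvg_cst].
  exact: plane_continuous.
have c2 : (0 +i* t : R[i]^o) @[t --> (0 : R)] --> (0 : R[i]^o).
  apply: (@continuous_comp _ _ _ (fun t : R => (0 : R, t)) (@plane R) 0).
    by apply: (@cvg_pair _ _ _ (nbhs (0 : R)) (nbhs (0 : R)) (nbhs (0 : R)));
      [exact: cvg_cst|exact: cvg_id].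
  exact: plane_continuous.
have n1 (t : R) : t != 0 -> (t%:C : R[i]^o) != 0 by apply: contra => /eqP[->].
have n2 (t : R) : t != 0 -> (0 +i* t : R[i]^o) != 0 by apply: contra => /eqP[->].
have F1 := F _ n1 c1; have F2 := F _ n2 c2.
have F11 : (fst \o (fun t : R => coords ((t%:C)^-1 * (u (t%:C + z) - u z)))) t
    @[t --> 0^'] --> (coords l).1.
  by apply: cvg_comp F1 _; exact: cvg_fst.
have F12 : (snd \o (fun t : R => coords ((t%:C)^-1 * (u (t%:C + z) - u z)))) t
    @[t --> 0^'] --> (coords l).2.
  by apply: cvg_comp F1 _; exact: cvg_snd.
have F21 : (fst \o (fun t : R => coords (((0 +i* t))^-1 * (u ((0 +i* t) + z) - u z)))) t
    @[t --> 0^'] --> (coords l).1.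
  by apply: cvg_comp F2 _; exact: cvg_fst.
have F22 : (snd \o (fun t : R => coords (((0 +i* t))^-1 * (u ((0 +i* t) + z) - u z)))) t
    @[t --> 0^'] --> (coords l).2.
  by apply: cvg_comp F2 _; exact: cvg_snd.
have I1 (t : R) (w : R[i]) : t != 0 ->
    (t%:C)^-1 * w = (t^-1 * complex.Re w) +i* (t^-1 * complex.Im w).
  move=> t0; apply: (mulfI (n1 t t0)); rewrite mulrA mulfV ?n1// mul1r.
  by case: w => a b; apply/eqP; rewrite eq_complex /= !mul0r subr0 addr0 !mulVKf// !eqxx.
have I2 (t : R) (w : R[i]) : t != 0 ->
    (0 +i* t)^-1 * w = (t^-1 * complex.Im w) +i* (- (t^-1 * complex.Re w)).
  move=> t0; apply: (mulfI (n2 t t0)); rewrite mulrA mulfV ?n2// mul1r.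
  case: w => a b; apply/eqP.
  by rewrite eq_complex /= !mul0r sub0r add0r mulrN opprK !mulVKf// !eqxx.
have P1 (t : R) : plane (t *: e1 R + coords z) = t%:C + z.
  by move: (z) => [x y]; apply/eqP; rewrite eq_complex /= scaler0 [t *: 1]mulr1 !eqxx.
have P2 (t : R) : plane (t *: e2 R + coords z) = (0 +i* t) + z.
  by move: (z) => [x y]; apply/eqP; rewrite eq_complex /= scaler0 [t *: 1]mulr1 !eqxx.
have ReB (a b : R[i]) : complex.Re (a - b) = complex.Re a - complex.Re b by case: a b => ? ? [].
have ImB (a b : R[i]) : complex.Im (a - b) = complex.Im a - complex.Im b by case: a b => ? ? [].
have D11 : 'D_(e1 R) (re_part u) (coords z) = (coords l).1.
  apply: cvg_lim => //;  apply: cvg_trans F11; apply: near_eq_cvg; near=> t.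
  have t0 : t != 0 by near: t; exact: nbhs_dnbhs_neq.
  by rewrite /= I1//= ReB /re_part P1 planeK.
have D12 : 'D_(e1 R) (im_part u) (coords z) = (coords l).2.
  apply: cvg_lim => //; apply: cvg_trans F12; apply: near_eq_cvg; near=> t.
  have t0 : t != 0 by near: t; exact: nbhs_dnbhs_neq.
  by rewrite /= I1//= ImB /im_part P1 planeK.
have D21 : 'D_(e2 R) (im_part u) (coords z) = (coords l).1.
  apply: cvg_lim => //; apply: cvg_trans F21; apply: near_eq_cvg; near=> t.
  have t0 : t != 0 by near: t; exact: nbhs_dnbhs_neq.
  change (complex.Re ((0 +i* t)^-1 * (u ((0 +i* t) + z) - u z)) =
    t^-1 * (im_part u (t *: e2 R + coords z) - im_part u (coords z))).
  by rewrite I2//= ImB /im_part P2 planeK.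
have D22 : 'D_(e2 R) (re_part u) (coords z) = - (coords l).2.
  apply: cvg_lim => //; apply: cvg_trans (cvgN F22); apply: near_eq_cvg; near=> t.
  have t0 : t != 0 by near: t; exact: nbhs_dnbhs_neq.
  change (- complex.Im ((0 +i* t)^-1 * (u ((0 +i* t) + z) - u z)) =
    t^-1 * (re_part u (t *: e2 R + coords z) - re_part u (coords z))).
  by rewrite I2//= opprK ReB /re_part P2 planeK.
by rewrite D11 D12 D21 D22.
Unshelve. all: by end_near. Qed.

(** The formula also holds at the zeros of [U]: the inverse of 0 is 0, the conventional value of the
    quotient. *)
Lemma dbar_quotientE (U : R[i]^o -> R[i]^o) p :
  dbar_quotient U (plane p) = Num.sqrt (dbar2 (re_part U) (im_part U) p) / 2 /
    Num.sqrt (re_part U p ^+ 2 + im_part U p ^+ 2).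
Proof.
rewrite /dbar_quotient; case: eqP => [U0|_].
  by rewrite /re_part /im_part U0 /= expr0n addr0 sqrtr0 invr0 mulr0.
congr (_ / _); last exact: normcE2.
rewrite /dbar Normc.normcM mulrC; congr (_ * _).
  rewrite normcE2 /partial coordsK /dbar2 /=.
  by congr Num.sqrt; rewrite !(mul0r, mul1r, sub0r, add0r).
by rewrite Normc.normcV normcE2 /=; congr (_^-1); rewrite addr0 expr0n addr0 sqrtr_sqr ger0_norm.
Qed.

(** The 4 compensates for the factor [1 / 2] in [dbar]. *)
Lemma dbar_quotient_sqr (U : R[i]^o -> R[i]^o) p :
  dbar2 (re_part U) (im_part U) p / (re_part U p ^+ 2 + im_part U p ^+ 2) =
  4 * dbar_quotient U (plane p) ^+ 2.
Proof.
rewrite dbar_quotientE !exprMn !exprVn !sqr_sqrtr ?addr_ge0 ?sqr_ge0//.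
by rewrite !mulrA; congr (_ / _); field.
Qed.

End complex_plane.

(** * Pointwise order against order in the L^2 sense *)

Section infinite_order.
Context {R : realType}.
Implicit Types (W : set (R * R)) (g : R * R -> R) (p z : R * R).

Local Notation mu2 := ((@lebesgue_measure R \x @lebesgue_measure R)%E).

Definition disc z (r : R) : set (R * R) := [set p | dist2 p z < r ^+ 2].

Lemma disc_open z r : open (disc z r).
Proof.
apply: (@open_comp _ _ (dist2 ^~ z) [set x | x < r ^+ 2]); last exact: open_lt.
by move=> p _; exact: dist2_continuous.
Qed.

Lemma disc_measurable z r :
  measurable (disc z r : set (measurableTypeR R * measurableTypeR R)).
Proof. by apply: open_measurable_plane; exact: disc_open. Qed.

Lemma disc_norm z r p : 0 <= r -> disc z r p -> `|p - z| < r.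
Proof.
move=> r0 /(le_lt_trans (sqr_norm_prod _)).
by rewrite ltr_sqr// nnegrE.
Qed.

(** The disc lies in a square of area [4 * r ^+ 2], so the scaled integral is at most a constant
    times [r ^+ (m + 2)], a fortiori times [r] for [r < 1]. *)
Lemma integral_disc_cvg0 W g z m (C t : R) : open W -> W z -> continuous_on W g ->
  0 < t -> (forall p, 0 <= g p) ->
  (forall p, `|p - z| < t -> g p <= C * (`|p - z| ^+ 2) ^+ m) ->
  ((r ^- m)%:E * \int[mu2]_(p in disc z r) (g p)%:E)%E @[r --> 0^'+] --> 0%E.
Proof.
move=> oW Wz cg t0 g0 gC.
have /nbhs_ballP[t1 /= t10 H1] : nbhs z W by exact: open_nbhs_nbhs.
pose C' := `|C|.
apply: (@squeeze_cvge _ _ _ _ (cst 0%E) _ (fun r : R => (4 * C' * r)%:E)).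
- near=> r; have r0 : 0 < r by near: r; exact: nbhs_right_gt.
  have r1 : r < 1 by near: r; exact: nbhs_right_lt.
  have rt : r < t by near: r; exact: nbhs_right_lt.
  have rt1 : r < t1 by near: r; exact: nbhs_right_lt.
  have rm : 0 < r ^- m by rewrite invr_gt0 exprn_gt0.
  apply/andP; split.
    by apply: mule_ge0; [rewrite lee_fin ltW|apply: integral_ge0 => p _; rewrite lee_fin].
  have dW : disc z r `<=` W.
    move=> p /(disc_norm (ltW r0)) pz; apply: H1; rewrite -ball_normE /= -normrN opprB.
    exact: lt_trans rt1.
  have mD := disc_measurable z r.
  have B : (\int[mu2]_(p in disc z r) (g p)%:E <= (C' * (r ^+ 2) ^+ m * (4 * r ^+ 2))%:E)%E.
    apply: (@le_trans _ _ (\int[mu2]_(p in disc z r) (cst (C' * (r ^+ 2) ^+ m)%:E p))%E).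
      apply: ge0_le_integral => //.
      - by move=> p _; rewrite lee_fin.
      - apply/measurable_EFinP; exact: (continuous_on_measurable oW mD dW cg).
      - move=> p /(disc_norm (ltW r0)) pz; rewrite lee_fin.
        apply: (le_trans (gC p (lt_trans pz rt))).
        apply: (@le_trans _ _ (C' * (`|p - z| ^+ 2) ^+ m)).
          by rewrite ler_wpM2r ?exprn_ge0 ?sqr_ge0// ler_norm.
        rewrite ler_wpM2l ?normr_ge0//; apply: lerXn2r; rewrite ?nnegrE ?sqr_ge0//.
        by apply: lerXn2r; rewrite ?nnegrE ?(ltW r0)// ltW.
    rewrite integral_cst// [leRHS]EFinM; apply: lee_wpmul2l.
      by rewrite lee_fin mulr_ge0 ?normr_ge0// exprn_ge0 ?sqr_ge0.
    rewrite -[leRHS](square_measure z r0); apply: le_measure; rewrite ?inE//.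
      exact: square_measurable.
    by move=> p /(disc_norm (ltW r0)) pz; apply/squareP; exact: ltW.
  apply: (@le_trans _ _ ((r ^- m)%:E * (C' * (r ^+ 2) ^+ m * (4 * r ^+ 2))%:E)%E).
    by apply: lee_wpmul2l => //; rewrite lee_fin ltW.
  rewrite -EFinM lee_fin.
  have -> : r ^- m * (C' * (r ^+ 2) ^+ m * (4 * r ^+ 2)) = 4 * C' * (r * (r ^+ m * r)).
    by rewrite -exprM mulnC exprM expr2; field; rewrite expf_neq0// gt_eqF.
  rewrite ler_wpM2l ?mulr_ge0 ?normr_ge0// -[leRHS]mulr1 ler_pM2l//.
  by rewrite -exprSr; apply: exprn_ile1; exact: ltW.
- exact: cvg_cst.
- rewrite (_ : 0%E = (4 * C' * 0)%:E); last by rewrite mulr0.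
  apply/cvg_EFin; first by near=> r.
  apply: cvgM; first exact: cvg_cst.
  exact/cvg_at_right_filter/cvg_id.
Unshelve. all: by end_near. Qed.

(** The disc contains a square of side [r / 4] centred at distance [r / 2] from [z]. Its points are
    at least [r / 4] away from [z], and its area is [r ^+ 2 / 16], so the integral is at least
    [c * (r ^+ 2 / 16) ^+ j.+1]: the exponent [2 * j.+1] cancels the power of [r]. *)
Lemma integral_disc_not_cvg0 W g z j (c t : R) : open W -> W z -> continuous_on W g ->
  0 < c -> 0 < t -> (forall p, 0 <= g p) ->
  (forall p, `|p - z| < t -> c * (`|p - z| ^+ 2) ^+ j <= g p) ->
  ~ (((r ^- (2 * j.+1)%N)%:E * \int[mu2]_(p in disc z r) (g p)%:E)%E @[r --> 0^'+] --> 0%E).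
Proof.
move=> oW Wz cg c0 t0 g0 gC cv.
have /nbhs_ballP[t1 /= t10 H1] : nbhs z W by exact: open_nbhs_nbhs.
pose K := c * (1 / 16) ^+ j.+1.
have K0 : 0 < K by rewrite mulr_gt0// exprn_gt0// divr_gt0.
have L : \forall r \near 0^'+,
    ((r ^- (2 * j.+1)%N)%:E * \int[mu2]_(p in disc z r) (g p)%:E < K%:E)%E.
  have KK : (0 < K%:E)%E by rewrite lte_fin.
  have NN : nbhs 0%E [set y | (y < K%:E)%E].
    by apply: open_nbhs_nbhs; split; [exact: open_ereal_lt_ereal|].
  by have := cv _ NN.
have [r [r0 rt rt1]] : exists r : R, [/\ 0 < r, r < t, r < t1 &
    ((r ^- (2 * j.+1)%N)%:E * \int[mu2]_(p in disc z r) (g p)%:E < K%:E)%E].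
  near (0 : R)^'+ => r; exists r; split; near: r => //.
  - exact: nbhs_right_gt.
  - exact: nbhs_right_lt.
  - exact: nbhs_right_lt.
rewrite ltNge => /negP; apply.
have rm : 0 < r ^- (2 * j.+1) by rewrite invr_gt0 exprn_gt0.
pose b : R * R := z + (r / 2, 0).
have r8 : 0 < r / 8 by rewrite divr_gt0.
have bz p : square b (r / 8) p -> r / 4 <= `|p - z| /\ disc z r p.
  move=> /squareP; rewrite norm_prod_le /= => /andP[p1 p2].
  have H : `|(p - z).1| <= `|p - z| by have := lexx `|p - z|; rewrite norm_prod_le => /andP[].
  move: p1 p2; rewrite /= !ler_norml => /andP[p1 p1'] /andP[p2 p2'].
  split.
    by apply: le_trans H; apply: le_trans (ler_norm _); rewrite /=; lra.
  rewrite /disc /dist2 /=.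
  have h1 : (p.1 - z.1) ^+ 2 <= (5 / 8 * r) ^+ 2.
    by apply: lerXn2r; rewrite ?nnegrE; lra.
  have h2 : (p.2 - z.2) ^+ 2 <= (1 / 8 * r) ^+ 2.
    rewrite -[leLHS]real_normK ?num_real//; apply: lerXn2r; rewrite ?nnegrE//; first by lra.
    by rewrite ler_norml; apply/andP; split; lra.
  have := exprn_gt0 2 r0; lra.
have dW : disc z r `<=` W.
  move=> p /(disc_norm (ltW r0)) pz; apply: H1; rewrite -ball_normE /= -normrN opprB.
  exact: lt_trans rt1.
have mD := disc_measurable z r.
have mg : measurable_fun (disc z r : set (measurableTypeR R * measurableTypeR R)) (EFin \o g).
  apply/measurable_EFinP; exact: (continuous_on_measurable oW mD dW cg).
have B : ((c * (r ^+ 2 / 16) ^+ j * (r ^+ 2 / 16))%:E <= \int[mu2]_(p in disc z r) (g p)%:E)%E.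
  apply: (@le_trans _ _ (\int[mu2]_(p in square b (r / 8)) (g p)%:E)%E); last first.
    apply: ge0_subset_integral => //; first exact: square_measurable.
      by move=> p _; rewrite lee_fin.
    by move=> p /bz[].
  apply: (@le_trans _ _ (\int[mu2]_(p in square b (r / 8)) (cst (c * (r ^+ 2 / 16) ^+ j)%:E p))%E).
    rewrite integral_cst//; last exact: square_measurable.
    rewrite [X in (_ <= _ * X)%E](_ : _ = (4 * (r / 8) ^+ 2)%:E); last exact: square_measure.
    by rewrite -EFinM lee_fin le_eqVlt; apply/orP; left; apply/eqP; congr (_ * _); field.
  apply: ge0_le_integral => //.
  - exact: square_measurable.
  - by move=> p _; rewrite lee_fin mulr_ge0 ?(ltW c0)// exprn_ge0// divr_ge0 ?sqr_ge0.
  - by apply: measurable_funS mg => // p /bz[].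
  - move=> p /bz[h1 /(disc_norm (ltW r0)) h2]; rewrite lee_fin.
    apply: le_trans (gC p (lt_trans h2 rt)).
    rewrite ler_pM2l//; apply: lerXn2r; rewrite ?nnegrE ?sqr_ge0 ?divr_ge0 ?sqr_ge0//.
    rewrite (_ : r ^+ 2 / 16 = (r / 4) ^+ 2); last by field.
    by apply: lerXn2r; rewrite ?nnegrE ?divr_ge0// ltW.
apply: (@le_trans _ _ ((r ^- (2 * j.+1)%N)%:E * (c * (r ^+ 2 / 16) ^+ j * (r ^+ 2 / 16))%:E)%E).
  rewrite -EFinM lee_fin le_eqVlt; apply/orP; left; apply/eqP.
  rewrite /K -mulrA -exprSr (_ : r ^+ 2 / 16 = r ^+ 2 * (1 / 16)); last by field.
  rewrite [(r ^+ 2 * _) ^+ _]exprMn exprM; set X := (r ^+ 2) ^+ _; set Y := (1 / 16) ^+ _.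
  have X0 : X != 0 by rewrite /X !expf_neq0// gt_eqF.
  by clearbody X Y; field.
by apply: lee_wpmul2l => //; rewrite lee_fin ltW.
Unshelve. all: by end_near. Qed.

End infinite_order.

(** * The identity theorem on a connected open set *)

Section identity_theorem.
Context {R : realType}.

Local Notation mu2 := ((@lebesgue_measure R \x @lebesgue_measure R)%E).

(** Points within [r / 4] of [z] are at squared Euclidean distance at most [r ^+ 2 / 2] from each
    other, so one flat zero [b] reaches all of them. *)
Lemma unique_continuation_near (W : set (R * R)) (z b : R * R) (r : R) (f h : R * R -> R) :
  open W -> square z (2 * r) `<=` W -> 0 < r -> r <= 1 / 4 ->
  Ck_on 2 W f -> Ck_on 2 W h ->
  (forall a, `|a - z| <= r / 4 -> mu2.-integrable (square a r)
    (EFin \o (fun p => dbar2 f h p / (f p ^+ 2 + h p ^+ 2)))) ->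
  (forall k, big_O_pow b k f) -> (forall k, big_O_pow b k h) -> `|b - z| <= r / 4 ->
  forall a, `|a - z| <= r / 4 -> f a ^+ 2 + h a ^+ 2 = 0.
Proof.
move=> oW sW r0 r4 Kf Kh iV Of Oh bz a az.
apply: (unique_continuation oW _ r0 r4 Kf Kh (iV a az) Of Oh).
  move=> p /squareP pa; apply: sW; apply/squareP.
  rewrite -[p](subrK a) -addrA; apply: (le_trans (ler_normD _ _)); lra.
apply: (le_lt_trans (dist2_norm_le _ _)).
have : `|b - a| ^+ 2 <= (r / 2) ^+ 2.
  apply: lerXn2r; rewrite ?nnegrE ?divr_ge0 ?(ltW r0)//.
  have -> : b - a = (b - z) - (a - z) by rewrite opprB addrA subrK.
  apply: (le_trans (ler_normB _ _)); lra.
have := exprn_gt0 2 r0; lra.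
Qed.

Lemma near0_big_O_pow z k (f : R * R -> R) : (\forall p \near z, f p = 0) -> big_O_pow z k f.
Proof. by move=> f0; exists 0; apply: filterS f0 => p ->; rewrite normr0 mul0r. Qed.

Lemma small_square (W : set (R * R)) (z : R * R) : open W -> W z ->
  exists r : R, [/\ 0 < r, r <= 1 / 4 & square z (2 * r) `<=` W].
Proof.
move=> oW Wz; have /nbhs_ballP[t /= t0 H] : nbhs z W by exact: open_nbhs_nbhs.
exists (Num.min (1 / 4) (t / 4)); split.
- by rewrite lt_min !divr_gt0.
- by rewrite ge_min lexx.
move=> p /squareP pz; apply: H; rewrite -ball_normE /= -normrN opprB.
apply: le_lt_trans pz _; have : Num.min (1 / 4) (t / 4) <= t / 4 by rewrite ge_min lexx orbT.
lra.
Qed.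

(** Unique continuation with quotient 0 takes the place of power series. The set [B] of points near
    which [U] vanishes is open; it is closed in [Omega] because a point of [B] close enough to [z]
    is a flat zero that forces [U] to vanish around [z]. *)
Lemma identity_theorem (Omega : set R[i]^o) (U : R[i]^o -> R[i]^o) :
  open Omega -> connected Omega ->
  Ck_on 2 (@plane R @^-1` Omega) (re_part U) ->
  Ck_on 2 (@plane R @^-1` Omega) (im_part U) ->
  (forall p, Omega (plane p) -> dbar2 (re_part U) (im_part U) p = 0) ->
  (exists2 w, Omega w & \forall z \near w, U z = 0) ->
  forall z, Omega z -> U z = 0.
Proof.
move=> oO cO Kf Kh d0 [w Ow w0].
pose B := Omega `&` [set z | \forall t \near z, U t = 0].
have oW := plane_open oO.
have step z : Omega z -> closure B z -> \forall t \near z, U t = 0.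
  move=> Oz cB.
  have Wz : (@plane R @^-1` Omega) (coords z) by rewrite /preimage /= planeK.
  have [r [r0 r4 sW]] := small_square oW Wz.
  have r40 : 0 < r / 4 by rewrite divr_gt0.
  have nz : \forall t \near z, `|coords t - coords z| < r / 4.
    have nB : nbhs (coords z) (ball (coords z) (r / 4)) by exact: nbhsx_ballx.
    have nb : \forall t \near z, ball (coords z) (r / 4) (coords t).
      exact: (coords_continuous (x := z) nB).
    by apply: filterS nb => t; rewrite -ball_normE /= -normrN opprB.
  have [b [[Ob b0] bz]] := cB _ nz.
  apply: filterS nz => t tz.
  suff : re_part U (coords t) ^+ 2 + im_part U (coords t) ^+ 2 = 0.
    move=> /eqP; rewrite paddr_eq0 ?sqr_ge0// !sqrf_eq0 /re_part /im_part planeK.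
    by move=> /andP[/eqP a1 /eqP a2]; apply/eqP; rewrite eq_complex /= a1 a2 !eqxx.
  have b0' := near_plane b0.
  apply: (unique_continuation_near (z := coords z) (b := coords b) oW sW r0 r4 Kf Kh).
  - move=> a az; have mS := square_measurable a r.
    have saW : square a r `<=` @plane R @^-1` Omega.
      move=> p /squareP pa; apply: sW; apply/squareP.
      rewrite -[p](subrK a) -addrA; apply: (le_trans (ler_normD _ _)); lra.
    apply: (@eq_integrable _ _ _ mu2 _ mS (cst 0%E)).
      by move=> p /set_mem /saW /d0 E; rewrite /= E mul0r.
    exact: integrable0.
  - by move=> k; apply: near0_big_O_pow; apply: filterS b0' => p; rewrite /re_part => ->.
  - by move=> k; apply: near0_big_O_pow; apply: filterS b0' => p; rewrite /im_part => ->.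
  - exact: ltW.
  - exact: ltW.
have BO : B = Omega.
  apply: cO.
  - by exists w.
  - exists (interior [set t | U t = 0]); first exact: open_interior.
    by [].
  - exists (closure B); first exact: closed_closure.
    apply/seteqP; split=> z; first by move=> Bz; split; [exact: Bz.1|exact: subset_closure].
    by move=> [Oz cz]; split; [exact: Oz|exact: step].
by move=> z; rewrite -BO => -[_ /nbhs_singleton].
Qed.

End identity_theorem.

(** * Measurability of the quotient *)

Section quotient.
Context {R : realType}.
Implicit Types (U : R[i]^o -> R[i]^o).

Local Notation T2 := (measurableTypeR R * measurableTypeR R)%type.

Lemma continuous_on_sqrt (W : set (R * R)) (g : R * R -> R) : continuous_on W g ->
  continuous_on W (fun p => Num.sqrt (g p)).
Proof.
by move=> cg p Wp; apply: continuous_comp; [exact: cg|exact: sqrt_continuous].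
Qed.

(** The quotient may be discontinuous at the zeros of [U], but it is continuous on the open set [E]
    where [U] is nonzero and constantly 0 on the rest. *)
Lemma dbar_quotient_measurable (W : set (R * R)) U : open W ->
  Ck_on 1 W (re_part U) -> Ck_on 1 W (im_part U) ->
  measurable_fun (W : set T2) (dbar_quotient U \o @plane R).
Proof.
move=> oW /Ck_on_C1[cf cf1 cf2 _] /Ck_on_C1[ch ch1 ch2 _].
pose s p := re_part U p * re_part U p + im_part U p * im_part U p.
have cs : continuous_on W s by apply: continuous_onD; exact: continuous_onM.
have cD : continuous_on W (dbar2 (re_part U) (im_part U)).
  have cA := continuous_onD cf1 (continuous_onN ch2).
  have cB := continuous_onD ch1 cf2.
  exact: continuous_onD (continuous_onM cA cA) (continuous_onM cB cB).
pose E := W `&` [set p | s p != 0].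
have oE : open E.
  rewrite openE => p [Wp sp]; apply: filterI; first exact: open_nbhs_nbhs.
  exact: (cvgr_neq0 _ (cs p Wp) sp).
have mE : measurable (E : set T2) by exact: open_measurable_plane.
have mW : measurable (W : set T2) by exact: open_measurable_plane.
have mWE : measurable (W `\` E : set T2) by exact: measurableD.
have EW : E `|` (W `\` E) = W.
  by apply: setDUK => p [].
rewrite -EW; apply/measurable_funU => //; split.
  rewrite (_ : _ \o _ = fun p => Num.sqrt (dbar2 (re_part U) (im_part U) p) * 2^-1 *
    (Num.sqrt (s p))^-1); last first.
    by apply/funext => p /=; rewrite dbar_quotientE !expr2.
  apply: (continuous_on_measurable oE mE (@subset_refl _ E)).
  have cW g : continuous_on W g -> continuous_on E g by move=> c p [Wp _]; exact: c.
  apply: continuous_onM.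
    by apply: continuous_onM; [exact/cW/continuous_on_sqrt|exact: continuous_on_cst].
  move=> p [Wp sp]; apply: continuousV.
    by rewrite gt_eqF// sqrtr_gt0 lt_neqAle eq_sym sp /s -!expr2 addr_ge0 ?sqr_ge0.
  exact: (continuous_on_sqrt cs).
have := @measurable_cst _ _ (T2 : measurableType _) (measurableTypeR R) (W `\` E) 0.
apply: eq_measurable_fun => p /set_mem[Wp nE]; rewrite /= dbar_quotientE.
have -> : re_part U p ^+ 2 + im_part U p ^+ 2 = 0.
  by apply: contrapT => /eqP sp; apply: nE; split=> //; rewrite /= /s -!expr2.
by rewrite sqrtr0 invr0 mulr0.
Qed.

End quotient.

Theorem corollary5p3 (R : realType) (Omega : set R[i]^o) (z0 : R[i]^o)
    (u : R[i]^o -> R[i]^o)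
    (Omega_open : open Omega)
    (Omega_connected : connected Omega)
    (z0_boundary : boundary Omega z0)
    (u_holomorphic : holomorphic_on Omega u)
    (u_nonconstant : nonconstant_on Omega u)
    (N : set R[i]^o) (U : R[i]^o -> R[i]^o)
    (U_extends : smooth_extension_across Omega N z0 u U)
    (U_z0 : U z0 = 0) :
  (vanishes_to_finite_order U z0 <->
     Lp_near +oo%E (Omega `|` N) z0 (dbar_quotient U)) /\
  (Lp_near +oo%E (Omega `|` N) z0 (dbar_quotient U) <->
     Lp_near 2%:E (Omega `|` N) z0 (dbar_quotient U)).
Proof.
move: U_extends => [[oN Nz0] SU Uu].
set z := coords z0; pose f := re_part U; pose h := im_part U.
pose A : set (R * R) := @plane R @^-1` Omega.
pose W : set (R * R) := @plane R @^-1` (Omega `|` N).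
have oW : open W by apply: plane_open; exact: openU.
have oA : open A by exact: plane_open.
have AW : A `<=` W by move=> p Ap; left.
have Wz : W z by rewrite /W /preimage /= planeK; right.
have Sf n : Ck_on n W f by have [] := SU n.
have Sh n : Ck_on n W h by have [] := SU n.
have cA : closure A z.
  move=> S /coords_continuous nS; have [w [Ow Sw]] := z0_boundary.1 _ nS.
  by exists (coords w); split; [rewrite /A /preimage /= planeK|exact: Sw].
have CR p : A p -> W p -> 'D_(e1 R) f p = 'D_(e2 R) h p /\ 'D_(e2 R) f p = - 'D_(e1 R) h p.
  move=> Ap _; have := @cauchy_riemann R u U (plane p) (u_holomorphic _ Ap).
  rewrite coordsK; apply.
  have : \forall w \near plane p, Omega w by exact: open_nbhs_nbhs.
  by apply: filterS => w /Uu.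
have d0 p : A p -> dbar2 f h p = 0.
  move=> Ap; have [e_1 e_2] := CR p Ap (AW p Ap).
  by rewrite /dbar2 e_1 e_2 subrr addrN !expr0n addr0.
pose s p := f p ^+ 2 + h p ^+ 2.
have s0 p : 0 <= s p by rewrite addr_ge0 ?sqr_ge0.
have cs : continuous_on W s.
  have [cf _ _ _] := Ck_on_C1 (Sf 1%N); have [ch _ _ _] := Ck_on_C1 (Sh 1%N).
  exact: continuous_onD (continuous_onM cf cf) (continuous_onM ch ch).
have infE m : \forall r \near (0 : R)^'+,
    ((r ^- m)%:E * \int[@lebesgue2 R]_(p in disc z r) (s p)%:E)%E =
    ((r ^- m)%:E * \int[@lebesgue2 R]_(p in @plane R @^-1` ball z0 r%:C)
          (Normc.normc (U (plane p)) ^+ 2)%:E)%E.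
  near=> r; have r0 : 0 < r by near: r; exact: nbhs_right_gt.
  rewrite ball_planeE//; congr (_ * _)%E; apply: eq_integral => p _.
  by rewrite normcE2 sqr_sqrtr ?addr_ge0 ?sqr_ge0.
(* Either exponent makes the quotient square-integrable on small squares, so flatness forces [U] to
   vanish near [z]. As [z] is in the closure of [A], the interior of the zero set meets [A], and the
   identity theorem makes [u] constant. *)
have flat_false (p : \bar R) : p = +oo%E \/ p = 2%:E ->
    Lp_near p (Omega `|` N) z0 (dbar_quotient U) ->
    (forall k, big_O_pow z k f) -> (forall k, big_O_pow z k h) -> False.
  move=> pE [S [[oS Sz0] SW LS]] Of Oh.
  have oS' : open (@plane R @^-1` S) by exact: plane_open.
  have Sz : (@plane R @^-1` S) z by rewrite /preimage /= planeK.
  have [r [r0 r4 sS]] := small_square oS' Sz.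
  have sub : @plane R @^-1` S `<=` W by move=> q /SW.
  have r40 : 0 < r / 4 by rewrite divr_gt0.
  have V0 : forall a, `|a - z| <= r / 4 -> f a ^+ 2 + h a ^+ 2 = 0.
    apply: (unique_continuation_near (b := z) oS' sS r0 r4
      (Ck_on_subset sub (Sf 2%N)) (Ck_on_subset sub (Sh 2%N)) _ Of Oh); last first.
      by rewrite subrr normr0 ltW.
    move=> a az; have aS : square a r `<=` @plane R @^-1` S.
      move=> q /squareP qa; apply: sS; apply/squareP.
      rewrite -[q](subrK a) -addrA; apply: (le_trans (ler_normD _ _)); lra.
    have iq : ((@lebesgue_measure R \x @lebesgue_measure R)%E).-integrable (square a r)
        (EFin \o (fun q => (dbar_quotient U \o @plane R) q ^+ 2)).
      case: pE => pE; rewrite pE in LS.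
        exact: (Lfuny_square_integrable oS' r0 aS LS).
      exact: (Lfun2_square_integrable oS' r0 aS LS).
    have := integrableZl (square_measurable a r) 4 iq.
    apply: eq_integrable; first exact: square_measurable.
    by move=> q _; rewrite /= dbar_quotient_sqr EFinM.
  have nz : \forall q \near z, f q ^+ 2 + h q ^+ 2 = 0.
    apply/nbhs_ballP; exists (r / 4) => //= q; rewrite -ball_normE /= -normrN opprB => /ltW.
    exact: V0.
  have nS : nbhs z (interior [set q | f q ^+ 2 + h q ^+ 2 = 0]).
    by apply: open_nbhs_nbhs; split; [exact: open_interior|exact: nz].
  have [b [Ab b0]] := cA _ nS.
  have U0 q : f q ^+ 2 + h q ^+ 2 = 0 -> U (plane q) = 0.
    move=> /eqP; rewrite paddr_eq0 ?sqr_ge0// !sqrf_eq0 /f /h /re_part /im_part.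
    by move=> /andP[/eqP a1 /eqP a2]; apply/eqP; rewrite eq_complex /= a1 a2 !eqxx.
  apply: u_nonconstant; exists 0 => w Ow; rewrite -Uu//.
  apply: (identity_theorem Omega_open Omega_connected (Ck_on_subset AW (Sf 2%N))
    (Ck_on_subset AW (Sh 2%N)) d0 _ Ow).
  exists (plane b); first exact: Ab.
  have nb : \forall t \near plane b, f (coords t) ^+ 2 + h (coords t) ^+ 2 = 0.
    have := @coords_continuous R (plane b) [set q | f q ^+ 2 + h q ^+ 2 = 0].
    by rewrite coordsK; apply.
  by apply: filterS nb => t /U0; rewrite planeK.
(* The statements stand or fall together: without a nonzero Taylor coefficient all three are false,
   with one all three are true. No implication between them is proved separately. *)
have [low|nlow] := pselect (exists j c1 c2, [/\ c1 ^+ 2 + c2 ^+ 2 != 0,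
    big_O_pow z j.+1 (fun p => f p - (c1 * (cpow j (p - z)).1 - c2 * (cpow j (p - z)).2)) &
    big_O_pow z j.+1 (fun p => h p - (c1 * (cpow j (p - z)).2 + c2 * (cpow j (p - z)).1))]);
  last first.
  have O k : big_O_pow z k f /\ big_O_pow z k h.
    by have [] := smooth_taylor_dichotomy k oW Wz oA cA Sf Sh CR.
  have inf : vanishes_to_infinite_order U z0.
    move=> m; have [/big_O_powP[C [r [C0 r0 HC]]] /big_O_powP[C' [r' [C0' r0' HC']]]] := O m.
    apply: (cvg_trans (near_eq_cvg (infE m))).
    apply: (integral_disc_cvg0 (C := C ^+ 2 + C' ^+ 2) (t := Num.min r r') oW Wz cs) => //.
      by rewrite lt_min r0.
    move=> p; rewrite lt_min => /andP[pr pr']; rewrite mulrDl.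
    have sq (x c : R) : 0 <= c -> `|x| <= c * `|p - z| ^+ m ->
        x ^+ 2 <= c ^+ 2 * (`|p - z| ^+ 2) ^+ m.
      move=> c0 xc; rewrite -exprM mulnC exprM -exprMn -[x ^+ 2]real_normK ?num_real//.
      by apply: lerXn2r; rewrite ?nnegrE ?mulr_ge0 ?exprn_ge0.
    by apply: lerD; apply: sq => //; [exact: HC|exact: HC'].
  have no p (pE : p = +oo%E \/ p = 2%:E) :
      ~ Lp_near p (Omega `|` N) z0 (dbar_quotient U).
    by move=> L; apply: (flat_false p pE L) => k; have [] := O k.
  have ny := no _ (or_introl erefl); have n2 := no _ (or_intror erefl).
  by split; split=> H; exfalso; [exact: H inf|exact: ny|exact: ny|exact: n2].
have [j [c1 [c2 [c0 B1 B2]]]] := low.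
have [c [t [c_0 t0 low_s]]] := taylor_lower_bound c0 B1 B2.
have fin : vanishes_to_finite_order U z0.
  move=> inf; apply: (integral_disc_not_cvg0 oW Wz cs c_0 t0 s0 low_s).
  apply: cvg_trans (inf (2 * j.+1)%N); apply: near_eq_cvg.
  by apply: filterS (infE (2 * j.+1)%N) => r ->.
have [_ [_ [Sf1 Sf2]]] := Sf j.+1; have [_ [_ [Sh1 Sh2]]] := Sh j.+1.
(* Of the flatness of [dbar U] only order [j] is used, the order of the lower bound for [|U|], so
   that the powers of [|p - z|] cancel in the quotient. *)
have /big_O_powP[C [r [C0 r0 HC]]] : big_O_pow z j ('D_(e1 R) f - 'D_(e2 R) h).
  apply: (big_O_pow_closure oW Wz oA cA); first exact: Ck_onD oW Sf1 (Ck_onN oW Sh2).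
  by move=> p Ap Wp; rewrite !fctE (CR p Ap Wp).1 subrr.
have /big_O_powP[C' [r' [C0' r0' HC']]] : big_O_pow z j ('D_(e1 R) h + 'D_(e2 R) f).
  apply: (big_O_pow_closure oW Wz oA cA); first exact: Ck_onD oW Sh1 Sf2.
  by move=> p Ap Wp; rewrite !fctE (CR p Ap Wp).2 addrN.
have /nbhs_ballP[t1 /= t10 H1] : nbhs z W by exact: open_nbhs_nbhs.
pose T := Num.min (Num.min t t1) (Num.min r r').
have T0 : 0 < T by rewrite !lt_min t0 t10 r0 r0'.
pose S : set R[i]^o := ball z0 T%:C.
have SE : @plane R @^-1` S = disc z T by exact: ball_planeE.
have Sin p : disc z T p -> [/\ `|p - z| < t, `|p - z| < t1, `|p - z| < r & `|p - z| < r'].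
  by move=> /(disc_norm (ltW T0)); rewrite !lt_min => /andP[/andP[? ?] /andP[? ?]].
have SW : disc z T `<=` W.
  by move=> p /Sin[_ pt _ _]; apply: H1; rewrite -ball_normE /= -normrN opprB.
pose K := (C ^+ 2 + C' ^+ 2) / c.
have qK p : disc z T p -> `|(dbar_quotient U \o @plane R) p| <= Num.sqrt (K / 4).
  move=> /Sin[pt _ pr pr']; rewrite -sqrtr_sqr ler_wsqrtr// ler_pdivlMr// mulrC.
  rewrite /= -dbar_quotient_sqr -/f -/h -/(s p).
  have [->|sn0] := eqVneq (s p) 0.
    by rewrite invr0 mulr0 /K divr_ge0 ?addr_ge0 ?sqr_ge0// ltW.
  have sp : 0 < s p by rewrite lt_neqAle eq_sym sn0 s0.
  have sq (x k : R) : 0 <= k -> `|x| <= k * `|p - z| ^+ j ->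
      x ^+ 2 <= k ^+ 2 * (`|p - z| ^+ 2) ^+ j.
    move=> k0 xk; rewrite -exprM mulnC exprM -exprMn -[x ^+ 2]real_normK ?num_real//.
    by apply: lerXn2r; rewrite ?nnegrE ?mulr_ge0 ?exprn_ge0.
  rewrite ler_pdivrMr//.
  apply: (@le_trans _ _ ((C ^+ 2 + C' ^+ 2) * (`|p - z| ^+ 2) ^+ j)).
    by rewrite mulrDl; apply: lerD; apply: sq => //; [exact: HC|exact: HC'].
  rewrite /K -mulrA ler_wpM2l ?addr_ge0 ?sqr_ge0// mulrC ler_pdivlMr// mulrC.
  exact: low_s.
have Sn : open_nbhs z0 S by apply: ball_open_nbhs; rewrite ltcR.
have SN : S `<=` Omega `|` N.
  by move=> w Sw; have := SW (coords w); rewrite -SE /W /preimage /= planeK; apply.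
have oD : open (disc z T) by exact: disc_open.
have Dsq : disc z T `<=` square z T.
  by move=> p /(disc_norm (ltW T0)) pz; apply/squareP; exact: ltW.
have [L2 Ly] := bounded_Lfun oD T0 Dsq (dbar_quotient_measurable oD
  (Ck_on_subset SW (Sf 1%N)) (Ck_on_subset SW (Sh 1%N))) qK.
have Lpy : Lp_near +oo%E (Omega `|` N) z0 (dbar_quotient U) by exists S; rewrite SE.
have Lp2 : Lp_near 2%:E (Omega `|` N) z0 (dbar_quotient U) by exists S; rewrite SE.
by [].
Unshelve. all: by end_near. Qed.
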